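(* Let $m,N\in\mathbb{N}$ with $m\ge1$ and $N>2(m+1)$, and let $u\in\mathcal{D}^{m+1,2}(\mathbb{R}^N)$ be such that $\int_{\mathbb{R}^N}|u|^2\,dx=1$. Then $$\left(\int_{\mathbb{R}^N}|\nabla^m u|^2\,dx\right)^{\frac1m}<\left(\int_{\mathbb{R}^N}|\nabla^{m+1}u|^2\,dx\right)^{\frac1{m+1}}.$$
   Context: All functions are real-valued. For $k\in\mathbb{N}$ with $N>2k$, $\mathcal{D}^{k,2}(\mathbb{R}^N)$ is the completion of $C_0^\infty(\mathbb{R}^N)$ with respect to the norm $\left(\sum_{|\alpha|=k}\|D^\alpha u\|_{L^2(\mathbb{R}^N)}^2\right)^{1/2}$; it embeds continuously into $L^{2N/(N-2k)}(\mathbb{R}^N)$. The notation $\nabla^k u$ means $\Delta^{k/2}u$ if $k$ is even and $\nabla\Delta^{(k-1)/2}u$ if $k$ is odd. *)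

(* Defs.v *)
From HB Require Import structures.
From mathcomp Require Import all_boot all_order all_algebra.
From mathcomp Require Import all_classical all_reals all_analysis.
Set Implicit Arguments.
Unset Strict Implicit.
Unset Printing Implicit Defensive.
Import Order.TTheory GRing.Theory Num.Theory.
Import numFieldNormedType.Exports.
Local Open Scope classical_set_scope.
Local Open Scope ring_scope.

Definition measure_rV_display : measure_display -> measure_display.
Proof. exact. Qed.

(* R^N is 'rV[R]_N. The product sigma-algebra on 'rV[T]_n, as for
   n.-tuple T in the library; for T = R it is the Borel sigma-algebra of R^n. *)
Section measurable_rV.
Context {d} {T : sigmaRingType d}.
Variable n : nat.

Let coors : 'I_n -> 'rV[T]_n -> T := fun i v => v ord0 i.

Let rV_set0 : g_sigma_preimage coors set0.
Proof. exact: sigma_algebra0. Qed.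

Let rV_setC A : g_sigma_preimage coors A -> g_sigma_preimage coors (~` A).
Proof. exact: sigma_algebraC. Qed.

Let rV_bigcup (F : _^nat) : (forall i, g_sigma_preimage coors (F i)) ->
  g_sigma_preimage coors (\bigcup_i (F i)).
Proof. exact: sigma_algebra_bigcup. Qed.

HB.instance Definition _ := @isMeasurable.Build (measure_rV_display d)
  'rV[T]_n (g_sigma_preimage coors) rV_set0 rV_setC rV_bigcup.

End measurable_rV.

Section measurable_coordinates.
Context d (T : sigmaRingType d) (n : nat).

Lemma measurable_rV_coord (i : 'I_n) :
  measurable_fun [set: 'rV[T]_n] (fun v => v ord0 i).
Proof.
move=> _ Y mY; rewrite setTI; apply: sub_sigma_algebra => /=.
rewrite -bigcup_seq/=; exists i => /=; first by rewrite mem_index_enum.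
by exists Y => //; rewrite setTI.
Qed.

Lemma measurable_fun_rVP d' (T' : measurableType d') (f : T' -> 'rV[T]_n) :
  (forall i, measurable_fun [set: T'] (fun x => f x ord0 i)) ->
  measurable_fun [set: T'] f.
Proof.
move=> mf _ A; move: A; apply: smallest_sub.
  split => [|A mA|F mF] /=.
  - by rewrite setTI preimage_set0; exact: measurable0.
  - by rewrite setTI setTD -preimage_setC; move: mA; rewrite setTI;
      exact: measurableC.
  - rewrite setTI preimage_bigcup; apply: bigcupT_measurable => k.
    by have := mF k; rewrite /= setTI.
move=> A; rewrite -bigcup_seq/= => -[i _ [B mB <-]]; rewrite !setTI.
by have := mf i measurableT B mB; rewrite setTI.
Qed.

End measurable_coordinates.

Lemma measurable_box d (T : measurableType d) n (A : 'I_n -> set T) :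
  (forall i, measurable (A i)) ->
  measurable [set v : 'rV[T]_n | forall i, A i (v ord0 i)].
Proof.
move=> mA.
rewrite (_ : [set _ | _] =
    \big[setI/setT]_(i < n) ((fun v : 'rV[T]_n => v ord0 i) @^-1` A i)).
  apply: bigsetI_measurable => i _.
  by rewrite -[X in measurable X]setTI; exact: measurable_rV_coord.
rewrite -bigcap_seq; apply/seteqP; split => [v Av i _|v Av i] /=; first exact: Av.
by apply: Av; rewrite /= mem_index_enum.
Qed.

Section lebesgue_measure_rV.
Context {R : realType}.

Definition rcons_rV n (p : 'rV[R]_n * measurableTypeR R) : 'rV[R]_n.+1 :=
  \row_i oapp (p.1 ord0) p.2 (unlift ord_max i).

Lemma measurable_rcons_rV n :
  measurable_fun [set: 'rV[R]_n * measurableTypeR R] (@rcons_rV n).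
Proof.
apply: measurable_fun_rVP => i.
under eq_fun do rewrite mxE.
case: unliftP => [j _|_] /=; last exact: measurable_snd.
exact: (measurableT_comp (measurable_rV_coord j) measurable_fst).
Qed.

Definition lebesgue_rVS n (mu : {measure set 'rV[R]_n -> \bar R}) :
    set 'rV[R]_n.+1 -> \bar R :=
  pushforward (mu \x lebesgue_measure)%E (@rcons_rV n).

Let lebesgue_rVS0 n mu : @lebesgue_rVS n mu set0 = 0%E.
Proof. by rewrite /lebesgue_rVS /pushforward preimage_set0 measure0. Qed.

Let lebesgue_rVS_ge0 n mu A : (0 <= @lebesgue_rVS n mu A)%E.
Proof. exact: (measure_ge0 (mu \x lebesgue_measure)%E). Qed.

Let lebesgue_rVS_sigma_additive n mu : semi_sigma_additive (@lebesgue_rVS n mu).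
Proof.
move=> F mF tF mUF.
have mr A : measurable A -> measurable (@rcons_rV n @^-1` A).
  by move=> mA; rewrite -[X in measurable X]setTI; exact: measurable_rcons_rV.
rewrite /lebesgue_rVS /pushforward preimage_bigcup.
apply: measure_semi_sigma_additive => [k||]; first exact: mr.
- apply/trivIsetP => i j _ _ ij; rewrite -preimage_setI.
  by move/trivIsetP : tF => /(_ _ _ _ _ ij) ->//; rewrite preimage_set0.
- by rewrite -preimage_bigcup; exact: mr.
Qed.

HB.instance Definition _ n mu := isMeasure.Build _ _ _ (@lebesgue_rVS n mu)
  (@lebesgue_rVS0 n mu) (@lebesgue_rVS_ge0 n mu)
  (@lebesgue_rVS_sigma_additive n mu).

Fixpoint lebesgue_rV (n : nat) : {measure set 'rV[R]_n -> \bar R} :=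
  match n with
  | 0 => \d_(0 : 'rV[R]_0)
  | n'.+1 => lebesgue_rVS (lebesgue_rV n')
  end.

End lebesgue_measure_rV.
Arguments lebesgue_rV : clear implicits.

Lemma lebesgue_rV_box (R : realType) n (A : 'I_n -> set R) :
  (forall i, measurable (A i)) ->
  lebesgue_rV R n [set v | forall i, A i (v ord0 i)] =
  (\prod_(i < n) lebesgue_measure (A i))%E.
Proof.
elim: n A => [|n IHn] A mA.
  by rewrite big_ord0 /= diracE mem_set// => -[].
rewrite big_ord_recr /= -IHn//.
have mB := @measurable_box _ _ n (fun i => A (widen_ord (leqnSn n) i))
  (fun i => mA _).
apply: eq_trans; last exact: (product_measure1E (lebesgue_rV R n)
  (@lebesgue_measure R) mB (mA ord_max)).
rewrite /lebesgue_rVS /pushforward; congr (product_measure1 _ _ _).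
apply/seteqP; split => [[v x] /= Avx|[v x] /= [Av Ax] i].
  split => [i|].
    have := Avx (widen_ord (leqnSn n) i); rewrite mxE.
    have -> : widen_ord (leqnSn n) i = lift ord_max i.
      by apply/val_inj => /=; rewrite /bump leqNgt ltn_ord.
    by rewrite liftK.
  by have := Avx ord_max; rewrite mxE unlift_none.
rewrite mxE; case: unliftP => [j ->|->] //=.
rewrite (_ : lift ord_max j = widen_ord (leqnSn n) j) //.
by apply/val_inj => /=; rewrite /bump leqNgt ltn_ord.
Qed.

Section smooth_functions.
Context {R : realType} {N : nat}.
Implicit Types (f g phi : 'rV[R]_N -> R) (s : seq 'I_N).

(* The iterated partial derivative d_(i1) ... d_(ik) f, for s = [:: i1; ...; ik]. *)
Definition partials s f : 'rV[R]_N -> R :=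
  foldr (fun i g => 'D_(delta_mx 0 i) g) f s.

Definition smooth f : Prop := forall s,
  continuous (partials s f) /\
  forall i x, derivable (partials s f) x (delta_mx 0 i).

(* C_0^oo(R^N) *)
Definition test_function : set ('rV[R]_N -> R) :=
  [set phi | smooth phi /\ compact (closure [set x | phi x != 0])].

Definition multi_order k (alpha : {ffun 'I_N -> 'I_k.+1}) : nat :=
  (\sum_i alpha i)%N.

Definition multi_partial k (alpha : {ffun 'I_N -> 'I_k.+1}) f :=
  partials (flatten [seq nseq (alpha i) i | i <- enum 'I_N]) f.

Definition Dnorm (k : nat) f : \bar R :=
  ((\sum_(alpha : {ffun 'I_N -> 'I_k.+1} | multi_order alpha == k)
      'N[lebesgue_rV R N]_2%:E[EFin \o multi_partial alpha f] `^ 2)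
    `^ 2^-1)%E.

(* D^(k,2)(R^N), for 2 * k < N. The completion is realized inside
   L^(2N/(N-2k))(R^N) through its continuous embedding: its elements are the
   L^(2N/(N-2k))-limits of the sequences of test functions that are Cauchy for
   Dnorm. Elements are functions, not classes modulo a.e. equality. *)
Definition Dspace (k : nat) : set ('rV[R]_N -> R) :=
  [set u | measurable_fun setT u /\
    exists phi : nat -> 'rV[R]_N -> R,
      [/\ forall n, test_function (phi n),
          forall e : R, 0 < e -> exists n0 : nat, forall i j : nat,
            (n0 <= i)%N -> (n0 <= j)%N -> (Dnorm k (phi i \- phi j)%R < e%:E)%E
        & ('N[lebesgue_rV R N]_((2 * N)%:R / (N - 2 * k)%:R)%:E
             [EFin \o (phi n \- u)%R])%E @[n --> \oo] --> 0%E]].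

End smooth_functions.

Section weak_derivatives.
Context {R : realType} {N : nat}.
Implicit Types (u g phi : 'rV[R]_N -> R) (s : seq 'I_N).
Local Notation mu := (lebesgue_rV R N).

Definition loc_integrable u : Prop := measurable_fun setT u /\
  forall K, compact K -> (\int[mu]_(x in K) `|u x|%:E < +oo)%E.

Definition is_weak_partials s u g : Prop :=
  [/\ loc_integrable u, loc_integrable g &
      forall phi, test_function phi ->
        \int[mu]_x (u x * partials s phi x) =
        (-1) ^+ size s * \int[mu]_x (g x * phi x)].

(* A weak derivative is unique up to a.e. equality; when it exists, weak_partials
   picks a representative (and it is the zero function otherwise). *)
Definition weak_partials s u : 'rV[R]_N -> R :=
  xget (fun=> 0) [set g | is_weak_partials s u g].

Definition weak_laplacian u : 'rV[R]_N -> R :=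
  fun x => \sum_i weak_partials [:: i; i] u x.

(* |nabla^k u|^2, Euclidean, where nabla^k u is Delta^(k/2) u for k even and
   nabla Delta^((k-1)/2) u for k odd. *)
Definition nabla_sqnorm (k : nat) u : 'rV[R]_N -> R :=
  let v := iter k./2 weak_laplacian u in
  fun x => if odd k then \sum_i weak_partials [:: i] v x ^+ 2 else v x ^+ 2.

End weak_derivatives.

(* Main.v *)
From HB Require Import structures.
Require Import Defs.
From mathcomp Require Import all_boot all_order all_algebra.
From mathcomp Require Import all_classical all_reals all_analysis.
From mathcomp Require Import measurable_realfun.
From mathcomp Require Import ring lra.
Import Order.TTheory GRing.Theory Num.Theory.
Import numFieldNormedType.Exports.
Local Open Scope classical_set_scope.
Local Open Scope ring_scope.
Set Implicit Arguments.
Unset Strict Implicit.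
Unset Printing Implicit Defensive.

(** Write a_k for the integral of |nabla^k u|^2, so that a_0 = 1.  Integration
    by parts gives a_k = - int nabla^(k-1) u . nabla^(k+1) u, hence, by the
    Cauchy-Schwarz inequality, a_k^2 <= a_(k-1) a_(k+1) for 1 <= k <= m
    ([green_grad], [green_lap], [energy_logconvex]).  For k = 1 the inequality
    is strict: equality would force Delta u = - a_1 u, and the Laplacian of R^N
    has no square-integrable eigenfunction ([eigen_eq0], [energy_strict]).
    Strictness at the first step propagates along the log-convex sequence and
    yields a_m^(m+1) < a_(m+1)^m ([log_convex_strict]).

    The absence of eigenfunctions is shown without Fourier analysis.  If u and
    w satisfy Delta u = - lam u and Delta w = - lam w, then Delta is symmetric
    on the pairs (u, sin (k x_i) w) and (sin (k x_i) u, w); the difference of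
    the two identities is
        k int cos (k x_i) (u d_i w - w d_i u) = 0
    ([eigen_cos]).  Dividing by k and letting k tend to 0 leaves
    int u d_i w = int w d_i u, whereas integration by parts gives the opposite
    sign, so that d_i u is orthogonal to every such w.  Difference quotients
    of u are such w and converge to d_i u, so d_i u = 0.  Then
    d_i (sin (k x_i) u) = k cos (k x_i) u is orthogonal to u, and k -> 0 once
    more gives u = 0.

    The other half of the work is that u has square-integrable derivatives of
    all orders up to m + 1, although the definition of the homogeneous space
    only controls the derivatives of order m + 1 of the test functions phi_n
    that approximate u.  All of it is done with the difference quotients
    [diffq i n f] of step 2^-n, which are bounded operators on L^2 and commute
    with one another.
    - Difference quotients of order m + 1 of phi_n - phi_l are bounded by the
      seminorm of phi_n - phi_l uniformly in the steps ([nrm_diffqs_Dnorm]);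
      with Fatou's lemma the same holds for phi_n - u
      ([Dspace_diffq_approximable]).
    - Since |D w|^2 <= |w| |D D w| in L^2 norms, the norms of words of
      intermediate length applied to u are bounded by those of words of length
      0 and m + 1 ([interpolation]).
    - Difference quotients of steps 2^-n and 2^-(n+1) differ by 2^-n / 4 times
      a second difference quotient, so they form a Cauchy sequence below the
      top order ([diffq_cauchy_bounded]); at the top order the Cauchy property
      comes from phi_n ([diffq_cauchy_approximable]).
    The limits are derivatives in the strong sense [sderiv], for which
    integration by parts is the limit of a summation by parts and needs only
    the translation invariance of Lebesgue measure ([sderiv_ibp]).  Strong
    derivatives are weak derivatives, and weak derivatives are unique almost
    everywhere ([integral_test_eq0], [is_weak_unique]), so the representatives
    chosen by [weak_partials] are the strong derivatives. *)

(** * Elementary facts on real numbers and sequences *)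

Lemma cvg_le_dist (R : realType) (u v : nat -> R) (l : R) :
  (forall n, `|u n - l| <= v n) -> v n @[n --> \oo] --> (0 : R) ->
  u n @[n --> \oo] --> l.
Proof.
move=> uv v0; apply/cvgrPdist_le => e e0; near=> n.
rewrite distrC; apply: le_trans (uv n) _.
apply: le_trans (ler_norm _) _; rewrite -[v n]subr0.
by near: n; move/cvgrPdistC_le : v0; exact.
Unshelve. all: by end_near. Qed.

Lemma cvg_sqr (R : realType) (u : nat -> R) (l : R) :
  u n @[n --> \oo] --> l -> u n ^+ 2 @[n --> \oo] --> l ^+ 2.
Proof.
by move=> ul; rewrite expr2; under eq_fun do rewrite expr2; exact: cvgM.
Qed.

(** A nonnegative binary quadratic form has a nonpositive discriminant; both
    Cauchy-Schwarz inequalities below come from here.  When B = 0 the form is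
    affine in b, which is why C must vanish. *)
Lemma discriminant_le (R : realFieldType) (A B C : R) : 0 <= A -> 0 <= B ->
  (forall a b, 0 <= a ^+ 2 * A - 2 * a * b * C + b ^+ 2 * B) -> C ^+ 2 <= A * B.
Proof.
move=> p q H.
have [B0|B0] := eqVneq B 0.
  have [C0|C0] := eqVneq C 0; first by rewrite C0 B0 mulr0 expr0n.
  have := H 1 ((A + 1) / (2 * C)); rewrite B0.
  have -> : 2 * 1 * ((A + 1) / (2 * C)) * C = A + 1 by field.
  by move=> ?; exfalso; lra.
(* The value of the form at (B, C) is B (A B - C^2). *)
have Bp : 0 < B by rewrite lt_def B0.
have := H B C.
have -> : B ^+ 2 * A - 2 * B * C * C + C ^+ 2 * B = B * (A * B - C ^+ 2) by ring.
by rewrite pmulr_rge0// subr_ge0.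
Qed.

(** * The space of square-integrable functions *)

Section L2.
Context d (T : measurableType d) (R : realType) (mu : {measure set T -> \bar R}).
Implicit Types (f g h : T -> R).

(** Functions, not classes: the norm below is a seminorm, and almost
    everywhere equality appears as [nrm (f - g) = 0]. *)
Definition L2 f := measurable_fun setT f /\ (\int[mu]_x ((f x) ^+ 2)%:E < +oo)%E.

Definition ip f g : R := \int[mu]_x (f x * g x).

Definition nrm f : R := Num.sqrt (ip f f).

Lemma measurable_sqr f : measurable_fun setT f ->
  measurable_fun setT (fun x => ((f x) ^+ 2)%:E).
Proof. by move=> mf; apply/measurable_EFinP; exact: measurable_funX. Qed.

Lemma L2_integrable_sqr f : L2 f -> mu.-integrable setT (EFin \o (fun x => f x ^+ 2)).
Proof.
case=> mf lf; apply/integrableP; split; first exact: measurable_sqr.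
by under eq_integral do rewrite /= ger0_norm ?sqr_ge0//.
Qed.

Lemma L2_integrable_mul f g : L2 f -> L2 g ->
  mu.-integrable setT (EFin \o (fun x => f x * g x)).
Proof.
move=> Lf Lg.
have := integrableD measurableT (L2_integrable_sqr Lf) (L2_integrable_sqr Lg).
apply: le_integrable => //.
  by apply/measurable_EFinP; apply: measurable_funM; [case: Lf|case: Lg].
move=> x _ /=; rewrite lee_fin [leRHS]ger0_norm ?addr_ge0 ?sqr_ge0//.
rewrite normrM -(real_normK (num_real (f x))) -(real_normK (num_real (g x))).
have := sqr_ge0 (`|f x| - `|g x|); have := sqr_ge0 (`|f x| + `|g x|).
by move: `|f x| `|g x| => a b; nra.
Qed.

Lemma L2D f g : L2 f -> L2 g -> L2 (f + g).
Proof.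
move=> Lf Lg; have [mf lf] := Lf; have [mg lg] := Lg.
have mfg : measurable_fun setT (f + g) by exact: measurable_funD.
split=> //.
have /integrableP[_] := integrableD measurableT
  (integrableD measurableT (L2_integrable_sqr Lf) (L2_integrable_sqr Lg))
  (integrableD measurableT (L2_integrable_mul Lf Lg) (L2_integrable_mul Lf Lg)).
congr (_ < _)%E; apply: eq_integral => x _ /=.
rewrite ger0_norm; first by congr EFin; rewrite fctE; ring.
have -> : f x ^+ 2 + g x ^+ 2 + (f x * g x + f x * g x) = (f x + g x) ^+ 2 by ring.
exact: sqr_ge0.
Qed.

Lemma L2Z a f : L2 f -> L2 (a *: f).
Proof.
move=> [mf lf]; split.
  by apply: measurable_funM => //; exact: measurable_cst.
under eq_integral do rewrite fctE exprMn EFinM.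
rewrite ge0_integralZl//.
- by rewrite lte_mul_pinfty// ?lee_fin ?sqr_ge0.
- exact: measurable_sqr.
- by move=> x _; rewrite lee_fin sqr_ge0.
- by rewrite lee_fin sqr_ge0.
Qed.

Lemma L2N f : L2 f -> L2 (- f).
Proof. by move=> /(L2Z (-1)); rewrite scaleN1r. Qed.

Lemma L2B f g : L2 f -> L2 g -> L2 (f - g).
Proof. by move=> Lf Lg; apply: L2D => //; exact: L2N. Qed.

Lemma L20 : L2 0.
Proof.
split; first exact: measurable_cst.
by under eq_integral do rewrite expr0n/=; rewrite integral0.
Qed.

Lemma L2_sum (I : Type) (r : seq I) (F : I -> T -> R) :
  (forall i, L2 (F i)) -> L2 (\sum_(i <- r) F i).
Proof.
by move=> LF; elim/big_ind : _ => //; [exact: L20|exact: L2D].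
Qed.

Lemma ipC f g : ip f g = ip g f.
Proof. by apply: eq_Rintegral => x _; rewrite mulrC. Qed.

Lemma ipDl f g h : L2 f -> L2 g -> L2 h -> ip (f + g) h = ip f h + ip g h.
Proof.
move=> Lf Lg Lh; rewrite /ip.
under eq_Rintegral do rewrite fctE mulrDl.
by rewrite RintegralD//; exact: L2_integrable_mul.
Qed.

Lemma ipZl a f g : L2 f -> L2 g -> ip (a *: f) g = a * ip f g.
Proof.
move=> Lf Lg; rewrite /ip.
under eq_Rintegral do rewrite fctE -mulrA.
by rewrite RintegralZl//; exact: L2_integrable_mul.
Qed.

Lemma ipDr f g h : L2 f -> L2 g -> L2 h -> ip h (f + g) = ip h f + ip h g.
Proof. by move=> *; rewrite ipC ipDl// ![ip _ h]ipC. Qed.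

Lemma ipZr a f g : L2 f -> L2 g -> ip g (a *: f) = a * ip g f.
Proof. by move=> *; rewrite ipC ipZl// ![ip _ g]ipC. Qed.

Lemma ipNl f g : L2 f -> L2 g -> ip (- f) g = - ip f g.
Proof. by move=> *; rewrite -scaleN1r ipZl// mulN1r. Qed.

Lemma ipBl f g h : L2 f -> L2 g -> L2 h -> ip (f - g) h = ip f h - ip g h.
Proof. by move=> Lf Lg Lh; rewrite ipDl ?ipNl//; exact: L2N. Qed.

Lemma ipBr f g h : L2 f -> L2 g -> L2 h -> ip h (f - g) = ip h f - ip h g.
Proof. by move=> *; rewrite ipC ipBl// ![ip _ h]ipC. Qed.

Lemma ip0l f : ip 0 f = 0.
Proof.
rewrite /ip; under eq_Rintegral do rewrite mul0r.
by rewrite /Rintegral integral0.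
Qed.

Lemma nrm0 : nrm 0 = 0.
Proof. by rewrite /nrm ip0l sqrtr0. Qed.

Lemma ip_suml (I : Type) (r : seq I) (F : I -> T -> R) h :
  (forall i, L2 (F i)) -> L2 h ->
  ip (\sum_(i <- r) F i) h = \sum_(i <- r) ip (F i) h.
Proof.
move=> LF Lh; elim: r => [|i r IH]; first by rewrite !big_nil ip0l.
by rewrite !big_cons ipDl ?IH//; exact: L2_sum.
Qed.

Lemma ip_sumr (I : Type) (r : seq I) (F : I -> T -> R) h :
  (forall i, L2 (F i)) -> L2 h ->
  ip h (\sum_(i <- r) F i) = \sum_(i <- r) ip h (F i).
Proof.
by move=> LF Lh; rewrite ipC ip_suml//; apply: eq_bigr => i _; rewrite ipC.
Qed.

Lemma ip_ge0 f : 0 <= ip f f.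
Proof. by apply: Rintegral_ge0 => x _; rewrite -expr2 sqr_ge0. Qed.

Lemma ip_combination a b f g : L2 f -> L2 g -> ip (a *: f - b *: g) (a *: f - b *: g) =
  a ^+ 2 * ip f f - 2 * a * b * ip f g + b ^+ 2 * ip g g.
Proof.
move=> Lf Lg; have La := L2Z a Lf; have Lb := L2Z b Lg.
by rewrite ipBl ?ipBr ?ipZl ?ipZr//; [rewrite (ipC g f); ring|exact: L2B].
Qed.

Lemma nrm_ge0 f : 0 <= nrm f. Proof. exact: sqrtr_ge0. Qed.

Lemma nrm_sqr f : nrm f ^+ 2 = ip f f.
Proof. by rewrite sqr_sqrtr// ip_ge0. Qed.

Lemma nrm_sqrE f : L2 f -> ((nrm f ^+ 2)%:E = \int[mu]_x (f x ^+ 2)%:E)%E.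
Proof.
move=> Lf; rewrite nrm_sqr /ip /Rintegral fineK//.
exact: (integrable_fin_num _ (L2_integrable_sqr Lf)).
Qed.

Lemma cauchy_schwarz f g : L2 f -> L2 g -> `|ip f g| <= nrm f * nrm g.
Proof.
move=> Lf Lg.
rewrite -(@ler_pXn2r _ 2)// ?nnegrE ?mulr_ge0 ?nrm_ge0//.
rewrite exprMn !nrm_sqr real_normK ?num_real//.
apply: discriminant_le; [exact: ip_ge0|exact: ip_ge0|move=> a b].
by rewrite -ip_combination// ip_ge0.
Qed.

Lemma nrmD f g : L2 f -> L2 g -> nrm (f + g) <= nrm f + nrm g.
Proof.
move=> Lf Lg; rewrite -(@ler_pXn2r _ 2)// ?nnegrE ?addr_ge0 ?nrm_ge0//.
rewrite sqrrD !nrm_sqr ipDl ?ipDr//; try exact: L2D.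
rewrite (ipC g f).
have := le_trans (ler_norm _) (cauchy_schwarz Lf Lg).
by move: (nrm f * nrm g) => *; lra.
Qed.

Lemma nrmZ a f : L2 f -> nrm (a *: f) = `|a| * nrm f.
Proof.
move=> Lf; rewrite /nrm ipZl ?ipZr//; last exact: L2Z.
by rewrite mulrA -expr2 sqrtrM ?sqr_ge0// sqrtr_sqr.
Qed.

Lemma nrmN f : L2 f -> nrm (- f) = nrm f.
Proof. by move=> Lf; rewrite -scaleN1r nrmZ// normrN1 mul1r. Qed.

Lemma nrmB f g : L2 f -> L2 g -> nrm (f - g) <= nrm f + nrm g.
Proof. by move=> Lf Lg; rewrite -(nrmN Lg); apply: nrmD => //; exact: L2N. Qed.

Lemma nrm_distC f g : L2 f -> L2 g -> nrm (f - g) = nrm (g - f).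
Proof. by move=> Lf Lg; rewrite -opprB nrmN//; exact: L2B. Qed.

Lemma nrm_triangle f g h : L2 f -> L2 g -> L2 h ->
  nrm (f - h) <= nrm (f - g) + nrm (g - h).
Proof.
move=> Lf Lg Lh; have -> : f - h = (f - g) + (g - h) by rewrite addrA subrK.
by apply: nrmD; exact: L2B.
Qed.

Lemma ler_nrm_dist f g : L2 f -> L2 g -> `|nrm f - nrm g| <= nrm (f - g).
Proof.
move=> Lf Lg; rewrite ler_norml; apply/andP; split.
  rewrite lerNl opprB lerBlDr addrC -{1}(subrK f g) addrC.
  by rewrite (nrm_distC Lf Lg); apply: nrmD => //; exact: L2B.
by rewrite lerBlDr -{1}(subrK g f); apply: nrmD => //; exact: L2B.
Qed.

Lemma ip_nrm0 f g : L2 f -> L2 g -> nrm f = 0 -> ip f g = 0.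
Proof.
move=> Lf Lg f0; apply/eqP; rewrite -normr_le0.
by apply: le_trans (cauchy_schwarz Lf Lg) _; rewrite f0 mul0r.
Qed.

Lemma ae_eq_nrm0 f g : L2 f -> L2 g -> ae_eq mu setT f g -> nrm (f - g) = 0.
Proof.
move=> Lf Lg fg; rewrite /nrm /ip /Rintegral (ge0_ae_eq_integral (g := cst 0%E))//.
- by rewrite integral0 sqrtr0.
- apply/measurable_EFinP; apply: measurable_funM; apply: measurable_funB;
  by [case: Lf|case: Lg].
- by move=> x _; rewrite lee_fin -expr2 sqr_ge0.
- by apply: filterS fg => x /(_ I) E _; rewrite !fctE E subrr mul0r.
Qed.

Lemma ae_eq_L2 f g : L2 f -> measurable_fun setT g -> ae_eq mu setT f g -> L2 g.
Proof.
move=> [mf lf] mg fg; split=> //.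
rewrite (ge0_ae_eq_integral (g := fun x => (f x ^+ 2)%:E))//.
- exact: measurable_sqr.
- exact: measurable_sqr.
- by move=> x _; rewrite lee_fin sqr_ge0.
- by move=> x _; rewrite lee_fin sqr_ge0.
- by apply: filterS fg => x /(_ I) E _; rewrite E.
Qed.

Lemma cvg_ip (f_ g_ : nat -> T -> R) f g :
  (forall n, L2 (f_ n)) -> (forall n, L2 (g_ n)) -> L2 f -> L2 g ->
  nrm (f_ n - f) @[n --> \oo] --> (0 : R) ->
  nrm (g_ n - g) @[n --> \oo] --> (0 : R) ->
  ip (f_ n) (g_ n) @[n --> \oo] --> ip f g.
Proof.
move=> Lf_ Lg_ Lf Lg cf cg.
pose B n := nrm (f_ n - f) * nrm (g_ n - g) + nrm (f_ n - f) * nrm g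
   + nrm f * nrm (g_ n - g).
have cB : B n @[n --> \oo] --> (0 : R).
  rewrite -[X in _ --> X](_ : 0 * 0 + 0 * nrm g + nrm f * 0 = 0 :> R); last by ring.
  by apply: cvgD; [apply: cvgD; [exact: cvgM|exact: cvgMl]|exact: cvgMr].
apply: cvg_le_dist cB => n; rewrite /B.
have L1 := L2B (Lf_ n) Lf; have L2' := L2B (Lg_ n) Lg.
have -> : ip (f_ n) (g_ n) - ip f g =
    ip (f_ n - f) (g_ n - g) + ip (f_ n - f) g + ip f (g_ n - g).
  by rewrite ipBr// ![ip (f_ n - f) _]ipBl// ipBr//; ring.
apply: le_trans (ler_normD _ _) _; apply: lerD; last exact: cauchy_schwarz.
apply: le_trans (ler_normD _ _) _; apply: lerD; exact: cauchy_schwarz.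
Qed.

Lemma cvg_ipl (f_ : nat -> T -> R) f g :
  (forall n, L2 (f_ n)) -> L2 f -> L2 g ->
  nrm (f_ n - f) @[n --> \oo] --> (0 : R) ->
  ip (f_ n) g @[n --> \oo] --> ip f g.
Proof.
move=> Lf_ Lf Lg cf; apply: (@cvg_ip f_ (fun=> g)) => //.
by under eq_fun do rewrite subrr nrm0; exact: cvg_cst.
Qed.

Lemma cvg_nrm (f_ : nat -> T -> R) f :
  (forall n, L2 (f_ n)) -> L2 f ->
  nrm (f_ n - f) @[n --> \oo] --> (0 : R) ->
  nrm (f_ n) @[n --> \oo] --> nrm f.
Proof.
by move=> Lf_ Lf cf; apply: cvg_le_dist cf => n; exact: ler_nrm_dist.
Qed.

(** The integral of the sum is the sum of the integrals, so the sum is finite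
    almost everywhere and its terms tend to zero there.  This replaces
    convergence in measure whenever an almost everywhere convergent
    subsequence is needed. *)
Lemma ae_cvg0_summable (F : nat -> T -> R) (c : nat -> R) :
  (forall n, measurable_fun setT (F n)) -> (forall n x, 0 <= F n x) ->
  (forall n, (\int[mu]_x (F n x)%:E <= (c n)%:E)%E) ->
  (\sum_(0 <= n <oo) (c n)%:E < +oo)%E ->
  \forall x \ae mu, F n x @[n --> \oo] --> (0 : R).
Proof.
move=> mF F0 Fc sc.
have mFE n : measurable_fun setT (fun x => (F n x)%:E) by apply/measurable_EFinP.
pose S x := (\sum_(0 <= n <oo) (F n x)%:E)%E.
have S0 x : (0 <= S x)%E by apply: nneseries_ge0 => n _ _; rewrite lee_fin.
have mS : measurable_fun setT S.
  by apply: ge0_emeasurable_sum => // k x _ _; rewrite lee_fin.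
have iS : mu.-integrable setT S.
  apply/integrableP; split=> //.
  under eq_integral do rewrite gee0_abs//.
  rewrite integral_nneseries//; last by move=> n x _; rewrite lee_fin.
  apply: le_lt_trans sc; apply: lee_nneseries => n _; last exact: Fc.
  by move=> _; apply: integral_ge0 => x _; rewrite lee_fin.
apply: filterS (integrable_ae measurableT iS) => x /(_ I) fS.
apply: cvg_series_cvg_0; apply: nondecreasing_is_cvgn.
  apply/nondecreasing_seqP => n; rewrite /series/= big_nat_recr//=.
  by rewrite lerDl.
exists (fine (S x)) => _ [n _ <-]; rewrite -lee_fin fineK// /series/= -sumEFin.
by apply: nneseries_lim_ge => k _ _; rewrite lee_fin.
Qed.

(** Fatou's lemma for the squares. *)
Lemma fatou_nrm (f_ : nat -> T -> R) f C :
  (forall n, L2 (f_ n)) -> measurable_fun setT f ->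
  (\forall n \near \oo, nrm (f_ n) <= C) ->
  (\forall x \ae mu, f_ n x @[n --> \oo] --> f x) ->
  L2 f /\ nrm f <= C.
Proof.
move=> Lf_ mf fC cf.
have C0 : 0 <= C.
  by have [n _ /(_ n (leqnn n))] := fC; apply: le_trans; exact: nrm_ge0.
have H : (\int[mu]_x (f x ^+ 2)%:E <= (C ^+ 2)%:E)%E.
  pose F (n : nat) x := (f_ n x ^+ 2)%:E.
  have F0 n x : (0 <= F n x)%E by rewrite lee_fin sqr_ge0.
  have mF n : measurable_fun setT (F n) by apply: measurable_sqr; exact: (Lf_ n).1.
  have -> : (\int[mu]_x (f x ^+ 2)%:E = \int[mu]_x limn_einf (F^~ x))%E.
    apply: ge0_ae_eq_integral => //.
    - exact: measurable_sqr.
    - rewrite (_ : (fun x => _) = (fun x => - limn_esup (fun n => - F n x))%E).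
        apply: measurableT_comp => //; apply: measurable_fun_limn_esup => n.
        exact: measurableT_comp.
      by apply/funext => x; rewrite (_ : limn_esup _ = - limn_einf (F^~ x))%E ?oppeK//.
    - by move=> x _; rewrite lee_fin sqr_ge0.
    - move=> x _; rewrite limn_einf_lim; apply: lime_ge; first exact: is_cvg_einfs.
      by apply: nearW => n; apply: le_ereal_inf_tmp => _ [k _ <-].
    - apply: filterS cf => x cfx _; apply/esym.
      apply: (cvg_limn_einf_sup _).1.
      by apply: cvg_EFin; [exact: nearW|exact: cvg_sqr].
  apply: le_trans (fatou mu measurableT mF (fun n x _ => F0 n x)) _.
  rewrite limn_einf_lim; apply: lime_le; first exact: is_cvg_einfs.
  apply: filterS fC => n fnC.
  apply: le_trans (_ : \int[mu]_x F n x <= _)%E.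
    by apply: ge_ereal_inf; exists (\int[mu]_x F n x)%E => //; exists n => /=.
  by rewrite -nrm_sqrE// lee_fin ler_pXn2r// nnegrE nrm_ge0.
have Lf : L2 f by split=> //; apply: le_lt_trans H _; rewrite ltry.
split=> //.
rewrite -(@ler_pXn2r _ 2)// ?nnegrE ?nrm_ge0//.
by rewrite -lee_fin nrm_sqrE.
Qed.

Lemma cvg_half_expn : (2^-1 : R) ^+ n @[n --> \oo] --> (0 : R).
Proof. by apply: cvg_expr; rewrite ger0_norm ?invf_lt1 ?ltr1n. Qed.

Lemma sum_half_lty : (\sum_(0 <= n <oo) ((2^-1 : R) ^+ n)%:E < +oo)%E.
Proof.
apply: (@le_lt_trans _ _ (2 : R)%:E); last by rewrite ltry.
apply: lime_le; first by apply: is_cvg_nneseries => n _ _; rewrite lee_fin exprn_ge0 ?ler0n.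
apply: nearW => n; rewrite sumEFin lee_fin.
have := @geometric_le_lim R n 1 2^-1 ler01.
rewrite (_ : 1 / (1 - 2^-1) = 2 :> R); last by field.
rewrite (_ : series _ _ = \sum_(0 <= i < n) 2^-1 ^+ i); last first.
  by apply: eq_bigr => k _; rewrite /= mul1r.
by apply; rewrite ?ger0_norm ?invf_lt1 ?ltr1n ?invr_gt0.
Qed.

Lemma cvg_geometric_steps (u : nat -> R) :
  (\forall n \near \oo, `|u n.+1 - u n| <= 2^-1 ^+ n) -> cvgn u.
Proof.
case=> n0 _ H; apply/cauchy_cvgP; apply: cauchy_exP => e e0.
have [n1 _ H1] : \forall n \near \oo, `|2^-1 ^+ n| < e / 2.
  have e20 : 0 < e / 2 by rewrite divr_gt0.
  by have := cvg_half_expn => /cvgr0_norm_lt /(_ _ e20).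
pose i := maxn n0 n1; exists (u i).
(* A bound that telescopes in k makes the induction immediate. *)
have step k : `|u (i + k)%N - u i| <= 2 * (2^-1 ^+ i - 2^-1 ^+ (i + k)).
  elim: k => [|k IH]; first by rewrite addn0 !subrr normr0 mulr0.
  have Hk : `|u (i + k).+1 - u (i + k)%N| <= 2^-1 ^+ (i + k).
    by apply: H => /=; rewrite (leq_trans (leq_maxl n0 n1))// leq_addr.
  rewrite addnS exprS.
  have -> : u (i + k).+1 - u i = (u (i + k).+1 - u (i + k)%N) + (u (i + k)%N - u i) by ring.
  apply: le_trans (ler_normD _ _) _.
  move: IH Hk; move: (2^-1 ^+ (i + k)) (2^-1 ^+ i) => a b; lra.
exists i => //= j ij; rewrite /ball/= distrC -(subnKC ij).
apply: le_lt_trans (step _) _.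
have := H1 i (leq_maxr n0 n1); rewrite ger0_norm ?exprn_ge0 ?ler0n// => Hi.
have : 0 <= (2^-1 : R) ^+ (i + (j - i)) by rewrite exprn_ge0.
move: Hi; move: (2^-1 ^+ (i + (j - i))) (2^-1 ^+ i) => a b; lra.
Qed.

(** Riesz-Fischer.  Along a rapidly Cauchy subsequence the increments at
    almost every point are eventually below a geometric sequence, so the
    subsequence converges there; Fatou's lemma turns this into convergence in
    norm of the whole sequence. *)
Lemma L2_complete (f_ : nat -> T -> R) : (forall n, L2 (f_ n)) ->
  (forall e, 0 < e -> exists n0 : nat, forall i j, (n0 <= i)%N -> (n0 <= j)%N ->
     nrm (f_ i - f_ j) <= e) ->
  exists g, L2 g /\ nrm (f_ n - g) @[n --> \oo] --> (0 : R).
Proof.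
move=> Lf_ Cf.
have /choice[N HN] : forall k : nat, exists n0 : nat, forall i j, (n0 <= i)%N -> (n0 <= j)%N ->
    nrm (f_ i - f_ j) <= 4^-1 ^+ k by move=> k; apply: Cf; rewrite exprn_gt0.
(* Partial sums make the extracted indices increasing and at least k. *)
pose m k := (\sum_(l < k.+1) (N l).+1)%N.
have mN k : (N k <= m k)%N by rewrite /m big_ord_recr/= (leq_trans (leqnSn _))// leq_addl.
have mS k : (m k <= m k.+1)%N by rewrite {2}/m big_ord_recr/= leq_addr.
have mle k l : (k <= l)%N -> (m k <= m l)%N.
  move=> kl; rewrite -(subnKC kl); elim: (l - k)%N => [|i IH]; first by rewrite addn0.
  by rewrite addnS (leq_trans IH).
pose g x := fine (limn_esup (fun k => (f_ (m k) x)%:E)).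
have mg : measurable_fun setT g.
  apply: measurableT_comp => //; apply: measurable_fun_limn_esup => n.
  by apply/measurable_EFinP; exact: (Lf_ _).1.
have cg : \forall x \ae mu, f_ (m k) x @[k --> \oo] --> g x.
  pose D k := 2 ^+ k *: (f_ (m k.+1) - f_ (m k)).
  have LD k : L2 (D k) by apply: L2Z; exact: L2B.
  have : \forall x \ae mu, (D k x) ^+ 2 @[k --> \oo] --> (0 : R).
    apply: (@ae_cvg0_summable (fun k x => D k x ^+ 2) (fun k => 2^-1 ^+ k)).
    - by move=> k; apply: measurable_funX; exact: (LD k).1.
    - by move=> k x; rewrite sqr_ge0.
    - move=> k; rewrite -(nrm_sqrE (LD k)) lee_fin nrmZ; last exact: L2B.
      have Hk : nrm (f_ (m k.+1) - f_ (m k)) <= 4^-1 ^+ k.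
        by apply: HN => //; exact: leq_trans (mS k).
      rewrite ger0_norm ?exprn_ge0 ?ler0n//.
      have {}Hk : 2 ^+ k * nrm (f_ (m k.+1) - f_ (m k)) <= 2^-1 ^+ k.
        apply: le_trans (ler_wpM2l _ Hk) _; first by rewrite exprn_ge0 ?ler0n.
        by rewrite -exprMn (_ : 2 * 4^-1 = 2^-1)//; field.
      apply: le_trans (_ : (2^-1 ^+ k) ^+ 2 <= _).
        by rewrite ler_pXn2r// ?nnegrE ?mulr_ge0 ?nrm_ge0 ?exprn_ge0 ?invr_ge0 ?ler0n.
      rewrite expr2 ler_piMl ?exprn_ge0 ?invr_ge0 ?ler0n//.
      by rewrite exprn_ile1 ?invr_ge0 ?invf_le1 ?ler1n ?ler0n.
    - exact: sum_half_lty.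
  apply: filterS => x Fx.
  have /cvg_ex[l cl] : cvgn (fun k => f_ (m k) x).
    apply: cvg_geometric_steps.
    have /cvgr0_norm_lt/(_ 1 ltr01) := Fx; apply: filterS => k /=.
    rewrite ger0_norm ?sqr_ge0// /D fctE !fctE => /ltW Hk.
    rewrite -(@ler_pXn2r _ 2)// ?nnegrE ?exprn_ge0 ?invr_ge0 ?ler0n//.
    rewrite real_normK ?num_real// exprVn exprVn.
    by rewrite -[leRHS]mul1r ler_pdivlMr ?exprn_gt0// mulrC -exprMn.
  rewrite /g (cvg_limn_einf_sup (l := l%:E) _).2//=.
  by apply: cvg_EFin; [exact: nearW|exact: cl].
have Hg e : 0 < e -> exists n0 : nat, forall n, (n0 <= n)%N -> L2 (f_ n - g) /\ nrm (f_ n - g) <= e.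
  move=> e0; have [n0 H0] := Cf e e0; exists n0 => n n0n.
  have [N1 HN1] : exists N1, forall k, (N1 <= k)%N -> (n0 <= m k)%N.
    have mk k : (k <= m k)%N.
      elim: k => // k IH; rewrite /m big_ord_recr/= addnS ltnS.
      exact: leq_trans IH (leq_addr _ _).
    by exists n0 => k n0k; exact: leq_trans n0k (mk k).
  apply: (@fatou_nrm (fun k => f_ n - f_ (m k))).
  - by move=> k; exact: L2B.
  - by apply: measurable_funB => //; exact: (Lf_ n).1.
  - by exists N1 => // k /HN1; exact: H0.
  - apply: filterS cg => x cx; rewrite !fctE.
    by apply: cvgB => //; exact: cvg_cst.
have Lg : L2 g.
  have [n0 /(_ n0 (leqnn n0))[H _]] := Hg 1 ltr01.
  by have := L2B (Lf_ n0) H; rewrite opprB addrCA subrr addr0.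
exists g; split=> //; apply/cvgrPdist_le => e e0.
have [n0 H0] := Hg e e0; exists n0 => // n /H0[_].
by rewrite sub0r normrN ger0_norm ?nrm_ge0.
Qed.

Lemma dominated_cvg_nrm (f_ : nat -> T -> R) f h :
  (forall n, L2 (f_ n)) -> L2 f -> L2 h ->
  (forall x, f_ n x @[n --> \oo] --> f x) ->
  (forall n x, `|f_ n x - f x| <= `|h x|) ->
  nrm (f_ n - f) @[n --> \oo] --> (0 : R).
Proof.
move=> Lf_ Lf Lh cf fh.
have LD n := L2B (Lf_ n) Lf.
have H1 n : measurable_fun setT (fun x => (((f_ n - f) x) ^+ 2)%:E).
  by apply: measurable_sqr; exact: (LD n).1.
have H2 : \forall x \ae mu, setT x -> (((f_ n - f) x) ^+ 2)%:E @[n --> \oo] --> cst (0%:E : \bar R) x.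
  apply: aeW => x _; apply: cvg_EFin; first exact: nearW.
  rewrite (_ : 0 = 0 ^+ 2 :> R); last by rewrite expr0n.
  by apply: cvg_sqr; rewrite -[X in _ --> X](subrr (f x)); apply: cvgB => //; exact: cvg_cst.
have H3 : \forall x \ae mu, forall n, setT x ->
    (`|(((f_ n - f) x) ^+ 2)%:E| <= (h x ^+ 2)%:E)%E.
  apply: aeW => x n _ /=; rewrite lee_fin ger0_norm ?sqr_ge0//.
  by rewrite -real_normK ?num_real// -[leRHS]real_normK ?num_real// ler_pXn2r ?nnegrE ?normr_ge0//; exact: fh.
have [_ _] := dominated_convergence measurableT H1 (measurable_cst _) H2
  (L2_integrable_sqr Lh) H3.
rewrite integral0.
under eq_fun do rewrite -(nrm_sqrE (LD _)).
move=> /fine_cvgP[_]; rewrite /comp/= => H.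
have : Num.sqrt (nrm (f_ n - f) ^+ 2) @[n --> \oo] --> Num.sqrt (0 : R).
  exact: (continuous_cvg _ (@sqrt_continuous R 0) H).
by rewrite sqrtr0; under eq_fun do rewrite sqrtr_sqr ger0_norm ?nrm_ge0//.
Qed.
End L2.

(** * Boxes, translation invariance and Borel sets in R^N *)

Section boxes.
Context {R : realType} {N : nat}.
Implicit Types (a b : 'I_N -> R).
Local Notation mu := (lebesgue_rV R N).

Definition box a b : set 'rV[R]_N :=
  [set v | forall i, (`]a i, b i[%classic : set R) (v ord0 i)].

Definition boxes : set (set 'rV[R]_N) := [set A | exists a b, A = box a b].

Definition cube (k : R) : set 'rV[R]_N := box (fun=> - k) (fun=> k).

Lemma measurable_box_itv a b : measurable (box a b).
Proof.
by apply: (@measurable_box _ (measurableTypeR R) _ (fun i => `]a i, b i[%classic)) => i;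
  exact: measurable_itv.
Qed.

Lemma setI_closed_boxes : setI_closed boxes.
Proof.
move=> _ _ [a [b ->]] [a' [b' ->]].
exists (fun i => Num.max (a i) (a' i)), (fun i => Num.min (b i) (b' i)).
apply/seteqP; split => [v [H1 H2] i|v H].
  have := H1 i; have := H2 i; rewrite /= !in_itv/= gt_max lt_min.
  by move=> /andP[-> ->] /andP[-> ->].
by split=> i; have := H i; rewrite /= !in_itv/= gt_max lt_min =>
  /andP[/andP[? ?]/andP[? ?]]; apply/andP.
Qed.

Lemma cube_cover (v : 'rV[R]_N) : exists k : nat, forall i, `|v ord0 i| < k%:R.
Proof.
(* The sum of the absolute values bounds every coordinate. *)
pose s := \sum_i `|v ord0 i|; exists (Num.truncn s).+1 => i.
apply: le_lt_trans (truncnS_gt s); rewrite /s (bigD1 i)//= lerDl.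
by apply: sumr_ge0.
Qed.

Lemma bigcup_cube : \bigcup_k cube k%:R = setT.
Proof.
apply/seteqP; split => // v _; have [k Hk] := cube_cover v.
by exists k => // i; rewrite /= in_itv/= -ltr_norml.
Qed.

(** The preimage of an interval by a coordinate is an increasing union of boxes
    whose other sides are the intervals from -k to k. *)
Lemma measurable_rV_boxes : (@measurable _ 'rV[R]_N) = <<s boxes >>.
Proof.
apply/seteqP; split; last first.
  apply: smallest_sub; first exact: sigma_algebra_measurable.
  by move=> _ [a [b ->]]; exact: measurable_box_itv.
apply: smallest_sub; first exact: smallest_sigma_algebra.
move=> A; rewrite -bigcup_seq/= => -[i _ [B mB <-]]; rewrite setTI.
have : (RGenOpens.G (R:=R)).-sigma.-measurable B by rewrite -RGenOpens.measurableE.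
move: B {mB}; apply: smallest_sub.
  split => [|B mB|F mF] /=.
  - by rewrite preimage_set0; exact: sigma_algebra0.
  - by rewrite setTD -preimage_setC -setTD; exact: sigma_algebraCD.
  - by rewrite preimage_bigcup; exact: sigma_algebra_bigcup.
move=> _ [x [y ->]] /=.
rewrite (_ : _ @^-1` _ = \bigcup_(k : nat)
   box (fun j => if j == i then x else - k%:R) (fun j => if j == i then y else k%:R)).
  apply: sigma_algebra_bigcup => k; apply: sub_sigma_algebra.
  by eexists; eexists.
apply/seteqP; split => v /=.
  move=> vi; have [k Hk] := cube_cover v; exists k => // j /=.
  by case: eqP => [->//|_]; rewrite in_itv/= -ltr_norml.
by case=> k _ /(_ i); rewrite /= eqxx.
Qed.

(** Open boxes form a generating pi-system. *)
Lemma measure_unique_boxes (m1 m2 : {measure set 'rV[R]_N -> \bar R}) :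
  (forall a b, m1 (box a b) = m2 (box a b)) ->
  (forall k : nat, (m1 (cube k%:R) < +oo)%E) ->
  forall A, measurable A -> m1 A = m2 A.
Proof.
move=> m12 m1fin A mA.
apply: (@measure_unique _ _ _ boxes (fun k => cube k%:R)) => //.
- exact: measurable_rV_boxes.
- exact: setI_closed_boxes.
- by move=> i; eexists; eexists.
- exact: bigcup_cube.
- by move=> _ [a [b ->]].
Qed.

Lemma lebesgue_rV_box_lty a b : (mu (box a b) < +oo)%E.
Proof.
rewrite (@lebesgue_rV_box _ _ (fun i => `]a i, b i[%classic)); last first.
  by move=> i; exact: measurable_itv.
suff /andP[] : (0 <= \prod_(i < N) lebesgue_measure (`]a i, b i[%classic : set R) < +oo)%E by [].
elim/big_ind : _ => [|x y /andP[x0 xoo] /andP[y0 yoo]|i _].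
- by rewrite ltry lee01.
- by rewrite mule_ge0//= lte_mul_pinfty// ge0_fin_numE.
- by rewrite measure_ge0/= lebesgue_measure_itv/=; case: ifP => _; rewrite ?ltry// -EFinB ltry.
Qed.

Definition translate (w v : 'rV[R]_N) := v + w.

Lemma measurable_translate w : measurable_fun setT (translate w).
Proof.
apply: measurable_fun_rVP => i.
rewrite (_ : (fun x => _) = (fun v : 'rV[R]_N => v ord0 i + w ord0 i)).
  apply: measurable_funD => //; exact: measurable_rV_coord.
by apply/funext => v; rewrite mxE.
Qed.

(** A translation maps boxes to boxes with sides of the same lengths. *)
Lemma lebesgue_rV_translate w A : measurable A ->
  pushforward mu (translate w) A = mu A.
Proof.
move=> mA.
apply/esym.
apply: (@measure_unique_boxes mu (pushforward mu (translate w) : {measure set _ -> \bar R})) => //.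
- exact: measurable_translate.
- move=> mt a b; apply/esym; rewrite /= /pushforward.
  have -> : translate w @^-1` box a b = box (fun i => a i - w ord0 i) (fun i => b i - w ord0 i).
    by apply/seteqP; split => v H i; have := H i;
      rewrite /= !in_itv/= mxE ltrBlDr ltrBrDr.
  rewrite !(@lebesgue_rV_box _ _ (fun i => `]_, _[%classic));
    try by move=> i; exact: measurable_itv.
  apply: eq_bigr => i _; rewrite !lebesgue_measure_itv/= !lte_fin ltrD2r.
  by case: ifP => // _; rewrite -!EFinB; congr EFin; ring.
- by move=> k; exact: lebesgue_rV_box_lty.
Qed.

Lemma ge0_integral_translate w (f : 'rV[R]_N -> \bar R) :
  measurable_fun setT f -> (forall x, 0 <= f x)%E ->
  (\int[mu]_x f (x + w)%R = \int[mu]_x f x)%E.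
Proof.
move=> mf f0.
have mt := measurable_translate w.
rewrite -[LHS](ge0_integral_pushforward mt mu measurableT mf (fun x _ => f0 x)).
apply: eq_measure_integral => A mA _.
exact: lebesgue_rV_translate.
Qed.

Lemma Rintegral_translate w (f : 'rV[R]_N -> R) :
  measurable_fun setT f ->
  (\int[mu]_x f (x + w)) = (\int[mu]_x f x).
Proof.
move=> mf; rewrite /Rintegral.
have mE : measurable_fun setT (EFin \o f) by exact/measurable_EFinP.
rewrite [in LHS]integralE [in RHS]integralE; congr (fine (_ - _)%E).
- rewrite -[RHS](ge0_integral_translate w (measurable_funepos mE) (funepos_ge0 _)).
  by apply: eq_integral => x _; rewrite !funeposE.
- rewrite -[RHS](ge0_integral_translate w (measurable_funeneg mE) (funeneg_ge0 _)).
  by apply: eq_integral => x _; rewrite !funenegE.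
Qed.

(** Every point of an open set lies in a cell of a fine enough grid that is
    contained in the set, and there are only countably many cells. *)
Lemma open_measurable_rV (U : set 'rV[R]_N) : open U -> measurable U.
Proof.
move=> oU.
pose Q (p : nat * {ffun 'I_N -> int}) : set 'rV[R]_N := [set v | forall i,
  (`[(p.2 i)%:~R / p.1.+1%:R, ((p.2 i)%:~R + 1) / p.1.+1%:R[%classic : set R) (v ord0 i)].
have mQ p : measurable (Q p).
  by apply: (@measurable_box _ (measurableTypeR R) _ (fun i => `[_, _[%classic)) => i;
    exact: measurable_itv.
rewrite (_ : U = \bigcup_(p in [set p | Q p `<=` U]) Q p).
  rewrite bigcup_mkcond; apply: countable_bigcupT_measurable => [|p].
    exact: countableP.
  by case: ifP.
apply/seteqP; split => [x Ux|x [p QU Qx]]; last exact: QU.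
have /nbhs_ballP[e /= e0 He] : nbhs x U by exact: open_nbhs_nbhs.
have [k] := ltr_add_invr e0; rewrite add0r => Hk.
have k0 : 0 < k.+1%:R :> R by rewrite ltr0n.
exists (k, [ffun i => Num.floor (x ord0 i * k.+1%:R)]) => [|i] /=; last first.
  rewrite ffunE in_itv/= ler_pdivrMr// ltr_pdivlMr//.
  by have := floor_itv (x ord0 i * k.+1%:R); rewrite intrD.
move=> y Qy; apply: He; split=> // j i; rewrite /ball/= ord1.
have := Qy i; rewrite /= ffunE in_itv/= ler_pdivrMr// ltr_pdivlMr//.
have := floor_itv (x ord0 i * k.+1%:R); rewrite intrD.
move: (_%:~R) => z /andP[x1 x2] /andP[y1 y2].
apply: le_lt_trans Hk.
rewrite -[leRHS]mul1r ler_pdivlMr// -[k.+1%:R in leLHS](gtr0_norm k0) -normrM mulrBl.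
by rewrite ler_norml; apply/andP; split; lra.
Qed.

Lemma continuous_measurable_rV (f : 'rV[R]_N -> R) : continuous f -> measurable_fun setT f.
Proof.
move=> /continuousP cf.
apply: (@measurability _ _ _ _ _ _ (RGenOpens.G (R := R))); first exact: RGenOpens.measurableE.
move=> _ [_ [x [y ->]] <-]; rewrite setTI; apply: open_measurable_rV.
by apply: cf; exact: interval_open.
Qed.

Lemma compact_measurable_rV (K : set 'rV[R]_N) : compact K -> measurable K.
Proof.
move=> cK; rewrite -[K]setCK; apply: measurableC; apply: open_measurable_rV.
by rewrite openC; apply: compact_closed => //; exact: norm_hausdorff.
Qed.

Lemma coord_le_norm (v : 'rV[R]_N) i : `|v ord0 i| <= `|v|.
Proof.
rewrite [leRHS]/Num.norm/= mx_normrE.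
exact: (le_bigmax _ (fun ij => `|v ij.1 ij.2|) (ord0, i)).
Qed.

Lemma compact_sub_cube (K : set 'rV[R]_N) : compact K ->
  exists k : nat, K `<=` cube k%:R.
Proof.
move=> /compact_bounded[M [_ HM]].
exists (Num.truncn (M + 1)).+1 => v Kv i; rewrite /= in_itv/= -ltr_norml.
apply: le_lt_trans (coord_le_norm v i) _; apply: le_lt_trans (truncnS_gt _).
by apply: HM => //; rewrite ltrDl.
Qed.

End boxes.

(** * Difference quotients and strong derivatives *)

Section difference_quotients.
Context {R : realType} {N : nat}.
Local Notation mu := (lebesgue_rV R N).
Local Notation V := 'rV[R]_N.
Local Notation L2 := (L2 mu).
Local Notation nrm := (nrm mu).
Local Notation ip := (ip mu).
Implicit Types (f g h : V -> R) (i j : 'I_N) (n m : nat).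

Definition shiftf (w : V) f : V -> R := fun x => f (x + w).

Definition dyshift i n f := shiftf (2^-1 ^+ n *: delta_mx 0 i) f.

Definition diffq i n f : V -> R := 2 ^+ n *: (dyshift i n f - f).

Lemma shiftfC w w' f : shiftf w (shiftf w' f) = shiftf w' (shiftf w f).
Proof. by apply/funext => x; rewrite /shiftf addrAC. Qed.

Lemma shiftfB w f g : shiftf w (f - g) = shiftf w f - shiftf w g. Proof. by []. Qed.

Lemma shiftfD w f g : shiftf w (f + g) = shiftf w f + shiftf w g. Proof. by []. Qed.

Lemma shiftfZ w a f : shiftf w (a *: f) = a *: shiftf w f. Proof. by []. Qed.

Lemma measurable_shiftf w f : measurable_fun setT f -> measurable_fun setT (shiftf w f).
Proof. by move=> mf; apply: (measurableT_comp mf (measurable_translate w)). Qed.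

Lemma L2_shiftf w f : L2 f -> L2 (shiftf w f).
Proof.
move=> [mf lf]; split; first exact: measurable_shiftf.
rewrite (ge0_integral_translate w (f := fun x => (f x ^+ 2)%:E))//.
  exact: measurable_sqr.
by move=> x; rewrite lee_fin sqr_ge0.
Qed.

Lemma ip_shiftf w f g : L2 f -> L2 g -> ip (shiftf w f) (shiftf w g) = ip f g.
Proof.
move=> [mf _] [mg _].
exact: (Rintegral_translate w (measurable_funM mf mg)).
Qed.

Lemma nrm_shiftf w f : L2 f -> nrm (shiftf w f) = nrm f.
Proof. by move=> Lf; rewrite /nrm ip_shiftf. Qed.

Lemma L2_dyshift i n f : L2 f -> L2 (dyshift i n f). Proof. exact: L2_shiftf. Qed.

Lemma nrm_dyshift i n f : L2 f -> nrm (dyshift i n f) = nrm f. Proof. exact: nrm_shiftf. Qed.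

Lemma L2_diffq i n f : L2 f -> L2 (diffq i n f).
Proof. by move=> Lf; apply: L2Z; apply: L2B => //; exact: L2_dyshift. Qed.

Lemma diffq_shiftf i n w f : diffq i n (shiftf w f) = shiftf w (diffq i n f).
Proof. by rewrite /diffq /dyshift shiftfC. Qed.

Lemma diffqD i n f g : diffq i n (f + g) = diffq i n f + diffq i n g.
Proof. by rewrite /diffq /dyshift shiftfD -scalerDr opprD addrACA. Qed.

Lemma diffqZ i n a f : diffq i n (a *: f) = a *: diffq i n f.
Proof. by rewrite /diffq /dyshift shiftfZ -scalerBr !scalerA mulrC. Qed.

Lemma diffqN i n f : diffq i n (- f) = - diffq i n f.
Proof. by rewrite -scaleN1r diffqZ scaleN1r. Qed.

Lemma diffqB i n f g : diffq i n (f - g) = diffq i n f - diffq i n g.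
Proof. by rewrite diffqD diffqN. Qed.

Lemma diffqC i n j m f : diffq i n (diffq j m f) = diffq j m (diffq i n f).
Proof. by rewrite {2}/diffq diffqZ diffqB diffq_shiftf. Qed.

Lemma two_half n : 2 ^+ n * 2^-1 ^+ n = 1 :> R.
Proof. by rewrite -exprMn divff ?expr1n// pnatr_eq0. Qed.

Lemma dyshiftB i n f : dyshift i n f - f = 2^-1 ^+ n *: diffq i n f.
Proof. by rewrite /diffq scalerA mulrC two_half scale1r. Qed.

Lemma dyshiftS i n f : dyshift i n f = dyshift i n.+1 (dyshift i n.+1 f).
Proof.
apply/funext => x; rewrite /dyshift /shiftf; congr f.
rewrite -addrA -scalerDl; congr (_ + _ *: _).
rewrite exprS; move: (2^-1 ^+ n) => a; lra.
Qed.

(** One step of size h is two steps of size h / 2: this gives the monotonicity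
    of the norm of difference quotients in the dyadic scale. *)
Lemma diffq_half i n f :
  diffq i n f = 2^-1 *: (diffq i n.+1 f + dyshift i n.+1 (diffq i n.+1 f)).
Proof.
rewrite {1}/diffq dyshiftS; apply/funext => x; rewrite /diffq /dyshift /shiftf !fctE.
by rewrite /GRing.scale/= (exprS 2 n); field.
Qed.

Lemma nrm_diffq_leS i n f : L2 f -> nrm (diffq i n f) <= nrm (diffq i n.+1 f).
Proof.
move=> Lf; have LD := L2_diffq i n.+1 Lf.
rewrite diffq_half nrmZ; last by apply: L2D => //; exact: L2_dyshift.
apply: le_trans (ler_wpM2l _ (nrmD LD (L2_dyshift _ _ LD))) _ => //.
by rewrite nrm_dyshift// ger0_norm//; lra.
Qed.

Lemma nrm_diffq_le i n m f : L2 f -> (n <= m)%N -> nrm (diffq i n f) <= nrm (diffq i m f).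
Proof.
move=> Lf nm; rewrite -(subnKC nm); elim: (m - n)%N => [|k IH]; first by rewrite addn0.
by rewrite addnS; apply: le_trans IH _; exact: nrm_diffq_leS.
Qed.

(** The source of the geometric rate of convergence of difference quotients of
    functions whose second difference quotients are bounded. *)
Lemma diffq_step i n f :
  diffq i n f - diffq i n.+1 f = (2^-1 ^+ n / 4) *: diffq i n.+1 (diffq i n.+1 f).
Proof.
have E : dyshift i n.+1 (diffq i n.+1 f) - diffq i n.+1 f = 2^-1 ^+ n.+1 *: diffq i n.+1 (diffq i n.+1 f).
  by rewrite dyshiftB.
rewrite diffq_half; move: E; set g := diffq i n.+1 f => E.
have -> : 2^-1 *: (g + dyshift i n.+1 g) - g = 2^-1 *: (dyshift i n.+1 g - g).
  by apply/funext => x; rewrite !fctE /GRing.scale/=; field.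
by rewrite E scalerA; congr (_ *: _); rewrite exprS; move: (2^-1 ^+ n) => a; lra.
Qed.

(** Summation by parts, from the invariance of the inner product under
    translations. *)
Lemma ip_diffql i n f g : L2 f -> L2 g -> ip (diffq i n f) g = - ip (dyshift i n f) (diffq i n g).
Proof.
move=> Lf Lg; have Lf' := L2_dyshift i n Lf; have Lg' := L2_dyshift i n Lg.
rewrite /diffq ipZl ?ipZr//; try exact: L2B.
by rewrite ipBl// ipBr// [ip (dyshift i n f) (dyshift i n g)]ip_shiftf//; ring.
Qed.

(** Interpolation between orders 0 and 2 with constant 1: the adjoint of a
    difference quotient is, up to sign and a translation, the same difference
    quotient. *)
Lemma nrm_diffq_interp i n f : L2 f ->
  nrm (diffq i n f) ^+ 2 <= nrm f * nrm (diffq i n (diffq i n f)).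
Proof.
move=> Lf; have LD := L2_diffq i n Lf.
rewrite nrm_sqr ip_diffql//; apply: le_trans (ler_norm _) _; rewrite normrN.
rewrite -(nrm_dyshift i n Lf); apply: cauchy_schwarz; first exact: L2_dyshift.
exact: L2_diffq.
Qed.

(** Only steps 2^-n are used, which makes the norms of the difference quotients
    monotone in n. *)
Definition sderiv i f g :=
  [/\ L2 f, L2 g & nrm (diffq i n f - g) @[n --> \oo] --> (0 : R)].

(** The norms of the difference quotients increase to the norm of the limit. *)
Lemma sderiv_nrm_diffq i n f g : sderiv i f g -> nrm (diffq i n f) <= nrm g.
Proof.
case=> Lf Lg fg.
have c : nrm (diffq i n f) @[n --> \oo] --> nrm g.
  by apply: cvg_nrm fg => // k; exact: L2_diffq.
rewrite -(cvg_lim _ c)//; apply: nondecreasing_cvgn_le; last by apply/cvg_ex; exists (nrm g).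
by apply/nondecreasing_seqP => k; exact: nrm_diffq_leS.
Qed.

Lemma sderiv_dyshift i f g : sderiv i f g -> nrm (dyshift i n f - f) @[n --> \oo] --> (0 : R).
Proof.
move=> fg; have [Lf Lg _] := fg.
apply: (@cvg_le_dist _ _ (fun n => 2^-1 ^+ n * nrm g)) => [n|].
  rewrite subr0 ger0_norm ?nrm_ge0// dyshiftB nrmZ; last exact: L2_diffq.
  rewrite ger0_norm ?exprn_ge0 ?invr_ge0//; apply: ler_wpM2l.
    by rewrite exprn_ge0 ?invr_ge0.
  exact: sderiv_nrm_diffq.
by rewrite -[X in _ --> X](mul0r (nrm g)); apply: cvgMl; exact: cvg_half_expn.
Qed.

(** The limit of [ip_diffql]; the translation disappears because translates of a
    differentiable function converge to it. *)
Lemma sderiv_ibp i f f' g g' : sderiv i f f' -> sderiv i g g' -> ip f' g = - ip f g'.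
Proof.
move=> ff gg; have [Lf Lf' cf] := ff; have [Lg Lg' cg] := gg.
have c1 : ip (diffq i n f) g @[n --> \oo] --> ip f' g.
  apply: cvg_ip => // [n|]; [exact: L2_diffq|].
  under eq_fun do rewrite subrr nrm0.
  exact: cvg_cst.
have c2 : - ip (dyshift i n f) (diffq i n g) @[n --> \oo] --> - ip f g'.
  apply: cvgN; apply: cvg_ip => // [n|n|]; [exact: L2_dyshift|exact: L2_diffq|exact: sderiv_dyshift ff].
have c3 : ip (diffq i n f) g @[n --> \oo] --> - ip f g'.
  by rewrite (_ : (fun n => _) = fun n => - ip (dyshift i n f) (diffq i n g)) //;
    apply/funext => n; rewrite ip_diffql.
by rewrite -(cvg_lim _ c1)// -(cvg_lim _ c3).
Qed.

Lemma sderivD i f f' g g' : sderiv i f f' -> sderiv i g g' -> sderiv i (f + g) (f' + g').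
Proof.
move=> [Lf Lf' cf] [Lg Lg' cg]; split; [exact: L2D|exact: L2D|].
apply: cvg_le_dist (_ : nrm (diffq i n f - f') + nrm (diffq i n g - g') @[n --> \oo] --> _).
  move=> n; rewrite subr0 ger0_norm ?nrm_ge0// diffqD opprD addrACA.
  by apply: nrmD; apply: L2B => //; exact: L2_diffq.
by rewrite -[X in _ --> X](addr0 0); exact: cvgD.
Qed.

Lemma sderivZ i a f f' : sderiv i f f' -> sderiv i (a *: f) (a *: f').
Proof.
move=> [Lf Lf' cf]; split; [exact: L2Z|exact: L2Z|].
rewrite (_ : (fun n => _) = fun n => `|a| * nrm (diffq i n f - f')).
  by rewrite -[X in _ --> X](mulr0 `|a|); apply: cvgMr.
by apply/funext => n; rewrite diffqZ -scalerBr nrmZ//; apply: L2B => //; exact: L2_diffq.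
Qed.

Lemma sderivB i f f' g g' : sderiv i f f' -> sderiv i g g' -> sderiv i (f - g) (f' - g').
Proof.
by move=> ff gg; rewrite -(scaleN1r g) -(scaleN1r g'); apply: sderivD => //; exact: sderivZ.
Qed.

Lemma sderiv0 i : sderiv i 0 0.
Proof.
split; [exact: L20|exact: L20|].
rewrite (_ : (fun n => _) = fun=> 0); first exact: cvg_cst.
by apply/funext => n; rewrite (_ : 0 = 0 *: (0 : V -> R)) ?diffqZ ?scale0r ?subrr ?nrm0.
Qed.

Lemma sderiv_shiftf i w f g : sderiv i f g -> sderiv i (shiftf w f) (shiftf w g).
Proof.
move=> [Lf Lg fg]; split; [exact: L2_shiftf|exact: L2_shiftf|].
rewrite (_ : (fun n => _) = fun n => nrm (diffq i n f - g))//.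
by apply/funext => n; rewrite diffq_shiftf -shiftfB nrm_shiftf//; apply: L2B => //; exact: L2_diffq.
Qed.

Lemma sderiv_diffq i j n f g : sderiv i f g -> sderiv i (diffq j n f) (diffq j n g).
Proof. by move=> fg; apply: sderivZ; apply: sderivB => //; exact: sderiv_shiftf. Qed.

(** Strong derivatives depend only on classes modulo null functions. *)
Lemma sderiv_congr i f g f' g' : sderiv i f g -> L2 f' -> L2 g' ->
  nrm (f - f') = 0 -> nrm (g - g') = 0 -> sderiv i f' g'.
Proof.
move=> [Lf Lg fg] Lf' Lg' ff gg; split=> //.
have D0 n : nrm (diffq i n (f - f')) = 0.
  have LD := L2B Lf Lf'; rewrite /diffq nrmZ; last by apply: L2B => //; exact: L2_dyshift.
  apply/eqP; rewrite mulf_eq0; apply/orP; right; rewrite eq_le nrm_ge0 andbT.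
  by apply: le_trans (nrmB (L2_dyshift _ _ LD) LD) _; rewrite nrm_dyshift// ff addr0.
apply: cvg_le_dist fg => n; rewrite subr0 ger0_norm ?nrm_ge0//.
have H1 := L2_diffq i n Lf'; have H2 := L2_diffq i n Lf.
apply: le_trans (nrm_triangle H1 H2 Lg') _; rewrite nrm_distC// -diffqB D0 add0r.
by apply: le_trans (nrm_triangle H2 Lg Lg') _; rewrite gg addr0.
Qed.

End difference_quotients.

(** * Test functions *)

Section test_functions.
Context {R : realType} {N : nat}.
Local Notation mu := (lebesgue_rV R N).
Local Notation V := 'rV[R]_N.
Local Notation L2 := (L2 mu).
Local Notation nrm := (nrm mu).
Local Notation ip := (ip mu).
Local Notation e_ i := (delta_mx 0 i : V).
Implicit Types (f g h phi psi : V -> R) (i j : 'I_N) (s : seq 'I_N).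

Lemma partialsD f g s : smooth f -> smooth g ->
  partials s (f + g) = partials s f + partials s g.
Proof.
move=> sf sg; elim: s => //= i s ->; apply/funext => x.
by rewrite deriveD//; [exact: (sf s).2|exact: (sg s).2].
Qed.

Lemma smoothD f g : smooth f -> smooth g -> smooth (f + g).
Proof.
move=> sf sg s; rewrite partialsD//; split=> [x|i x].
  by apply: continuousD; [exact: (sf s).1|exact: (sg s).1].
by apply: derivableD; [exact: (sf s).2|exact: (sg s).2].
Qed.

Lemma partialsZ a f s : smooth f -> partials s (a *: f) = a *: partials s f.
Proof.
move=> sf; elim: s => //= i s ->; apply/funext => x.
by rewrite deriveZ//; exact: (sf s).2.
Qed.

Lemma smoothZ a f : smooth f -> smooth (a *: f).
Proof.
move=> sf s; rewrite partialsZ//; split=> [x|i x].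
  exact: (@cvgZ _ _ _ _ _ (fun=> a) _ _ _ (cvg_cst a) ((sf s).1 x)).
by apply: derivableZ; exact: (sf s).2.
Qed.

Lemma quotient_shiftf w f x v :
  (fun t : R => t^-1 *: ((shiftf w f \o shift x) (t *: v) - shiftf w f x)) =
  (fun t => t^-1 *: ((f \o shift (x + w)) (t *: v) - f (x + w))).
Proof. by apply/funext => t; rewrite /= /shiftf addrA. Qed.

Lemma derivative_shiftf w f v :
  (fun x => 'D_v (shiftf w f) x) = shiftf w (fun x => 'D_v f x).
Proof.
by apply/funext => x; rewrite /derive quotient_shiftf.
Qed.

Lemma partials_shiftf w f s : partials s (shiftf w f) = shiftf w (partials s f).
Proof. by elim: s => //= i s ->; exact: derivative_shiftf. Qed.

Lemma smooth_shiftf w f : smooth f -> smooth (shiftf w f).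
Proof.
move=> sf s; rewrite partials_shiftf; split=> [x|i x].
  change {for x, continuous (partials s f \o (fun y => y + w))}.
  apply: continuous_comp; last exact: (sf s).1.
  by have := @cvgD R V V (nbhs x) _ id (cst w) x w cvg_id (cvg_cst w); exact.
by have := (sf s).2 i (x + w); rewrite /derivable quotient_shiftf.
Qed.

Lemma smooth_partial i f : smooth f -> smooth ('D_(e_ i) f).
Proof.
move=> sf s; have := sf (rcons s i).
by rewrite /partials foldr_rcons.
Qed.

Lemma test_smooth phi : test_function phi -> smooth phi. Proof. by case. Qed.

Lemma test_of_support phi (A : set V) : smooth phi -> compact (closure A) ->
  (forall x, phi x != 0 -> closure A x) -> test_function phi.
Proof.
move=> sphi cA H; split=> //.
apply: subclosed_compact cA _; first exact: closed_closure.
by rewrite [X in _ `<=` X]((closure_id _).1 (@closed_closure _ A)); exact: closure_subset.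
Qed.

Lemma test_cube phi : test_function phi ->
  exists k : nat, forall x, ~ cube k%:R x -> phi x = 0.
Proof.
case=> _ /compact_sub_cube[k Hk]; exists k => x xk.
by apply: contrapT => /eqP px; apply: xk; apply: Hk; exact: subset_closure.
Qed.

Lemma testD phi psi : test_function phi -> test_function psi -> test_function (phi + psi).
Proof.
move=> [sp cp] [sq cq].
apply: (@test_of_support _ ([set x | phi x != 0] `|` [set x | psi x != 0])).
- exact: smoothD.
- by rewrite closureU; exact: compactU.
- move=> x H; apply: subset_closure => /=; apply: contrapT => /not_orP[].
  move=> /negP; rewrite negbK => /eqP p0 /negP; rewrite negbK => /eqP q0.
  by move: H; rewrite fctE p0 q0 addr0 eqxx.
Qed.

Lemma testZ a phi : test_function phi -> test_function (a *: phi).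
Proof.
move=> [sp cp].
apply: (@test_of_support _ [set x | phi x != 0]) => //.
- exact: smoothZ.
- move=> x H; apply: subset_closure => /=; apply: contra_neq H => p0.
  by rewrite fctE p0 scaler0.
Qed.

Lemma testN phi : test_function phi -> test_function (- phi).
Proof. by move=> /(testZ (-1)); rewrite scaleN1r. Qed.

Lemma testB phi psi : test_function phi -> test_function psi -> test_function (phi - psi).
Proof. by move=> tp tq; apply: testD => //; exact: testN. Qed.

(** Outside the closed support the function vanishes near every point, so its
    derivative vanishes as well. *)
Lemma test_partial i phi : test_function phi -> test_function ('D_(e_ i) phi).
Proof.
move=> [sp cp].
apply: (@test_of_support _ [set x | phi x != 0]) => //.
  exact: smooth_partial.
move=> x; apply: contra_neqP => xA.
have oA : open (~` closure [set x | phi x != 0]) by rewrite openC; exact: closed_closure.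
rewrite (near_eq_derive (g := cst 0)) ?derive_cst//.
have : nbhs x (~` closure [set x | phi x != 0]) by exact: open_nbhs_nbhs.
apply: filterS => y yA; apply: contrapT => /eqP py; apply: yA.
exact: subset_closure.
Qed.

Lemma test_partials s phi : test_function phi -> test_function (partials s phi).
Proof. by move=> tp; elim: s => //= i s; exact: test_partial. Qed.

(** Replaces the compactness of the support by a condition that passes easily
    through translations and products. *)
Lemma test_of_cube phi (k : R) : smooth phi -> (forall x, ~ cube k x -> phi x = 0) ->
  test_function phi.
Proof.
move=> sp H; split=> //; apply: bounded_closed_compact; last exact: closed_closure.
exists (Num.max k 0); split; first exact: num_real.
move=> M kM x.
have cB : closed [set y : V | `|y| <= M].
  apply: (@preimage_closed _ _ (@Num.norm _ V) [set z | z <= M]); last exact: closed_le.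
  by move=> y _; exact: norm_continuous.
suff : closure [set x | phi x != 0] `<=` [set y : V | `|y| <= M] by exact.
rewrite [X in _ `<=` X]((closure_id _).1 cB); apply: closure_subset => y /= py.
have ky : cube k y by apply: contrapT => /H /eqP; apply/negP.
apply: le_trans (ltW kM).
rewrite [leLHS]/Num.norm/= mx_normrE; apply: bigmax_le => [|[j i] _].
  by rewrite le_max lexx orbT.
rewrite le_max; apply/orP; left.
by have := ky i; rewrite /= (ord1 j) in_itv/= -ltr_norml => /ltW.
Qed.

Lemma test_shiftf w phi : test_function phi -> test_function (shiftf w phi).
Proof.
move=> tp; have [k Hk] := test_cube tp.
apply: (@test_of_cube _ (k%:R + `|w|)); first exact/smooth_shiftf/test_smooth.
move=> x Hx; apply: Hk => Hk; apply: Hx => i.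
have := Hk i; rewrite /= !in_itv/= -!ltr_norml mxE => H.
have := coord_le_norm w i.
have := ler_normB (x ord0 i + w ord0 i) (w ord0 i); rewrite addrK; lra.
Qed.

Lemma test_diffq i n phi : test_function phi -> test_function (diffq i n phi).
Proof. by move=> tp; apply: testZ; apply: testB => //; exact: test_shiftf. Qed.

Lemma test_bounded phi : test_function phi -> exists B, forall x, `|phi x| <= B.
Proof.
move=> tp; have [sp cp] := tp.
have : compact [set phi x | x in closure [set x | phi x != 0]].
  apply: continuous_compact => //; apply: continuous_subspaceT.
  exact: (sp [::]).1.
move=> /compact_bounded[M [_ HM]]; exists (Num.max (M + 1) 0) => x.
have [p0|p0] := eqVneq (phi x) 0; first by rewrite p0 normr0 le_max lexx orbT.
rewrite le_max; apply/orP; left; apply: HM; first by rewrite ltrDl.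
by exists x => //; exact: subset_closure.
Qed.

Lemma test_measurable phi : test_function phi -> measurable_fun setT phi.
Proof. by move=> tp; apply: continuous_measurable_rV; exact: (test_smooth tp [::]).1. Qed.

Lemma L2_bounded_cube f (B k : R) : measurable_fun setT f ->
  (forall x, `|f x| <= B) -> (forall x, ~ cube k x -> f x = 0) -> L2 f.
Proof.
move=> mf fB f0; split=> //.
have mC : measurable (cube k : set V) by exact: measurable_box_itv.
apply: (@le_lt_trans _ _ (\int[mu]_x ((B ^+ 2)%:E * (\1_(cube k : set V) x)%:E))%E).
  apply: ge0_le_integral => //.
  - by move=> x _; rewrite lee_fin sqr_ge0.
  - exact: measurable_sqr.
  - by apply/measurable_EFinP; apply: measurable_funM => //; exact: measurable_indic.
  - move=> x _; rewrite -EFinM lee_fin indicE.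
    have [xk|xk] := pselect (cube k x).
      rewrite mem_set// mulr1 -real_normK ?num_real// ler_pXn2r ?nnegrE//.
      exact: le_trans (fB x).
    by rewrite f0// expr0n mulr_ge0 ?sqr_ge0.
rewrite ge0_integralZl//.
- by rewrite integral_indic// setIT lte_mul_pinfty// ?lebesgue_rV_box_lty// lee_fin sqr_ge0.
- by apply/measurable_EFinP; exact: measurable_indic.
- by rewrite lee_fin sqr_ge0.
Qed.

Lemma L2_cube (B k : R) : L2 (fun x => B * \1_(cube k : set V) x).
Proof.
apply: (@L2_bounded_cube _ `|B| k).
- by apply: measurable_funM => //; apply: measurable_indic; exact: measurable_box_itv.
- by move=> x; rewrite normrM indicE; case: (_ \in _); rewrite ?normr1 ?mulr1// normr0 mulr0.
- by move=> x xk; rewrite indicE memNset// mulr0.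
Qed.

Lemma test_L2 phi : test_function phi -> L2 phi.
Proof.
move=> tp; have [k Hk] := test_cube tp; have [B HB] := test_bounded tp.
by apply: (L2_bounded_cube _ HB Hk); exact: test_measurable.
Qed.

Lemma mvt_dir f (v x : V) (a : R) : 0 < a -> (forall y, derivable f y v) ->
  exists2 c, c \in `]0, a[ & f (x + a *: v) - f x = 'D_v f (x + c *: v) * a.
Proof.
move=> a0 df.
have E t : (fun u : R => u^-1 *: (((fun t => f (x + t *: v)) \o shift t) (u *: 1) - f (x + t *: v))) =
    (fun u => u^-1 *: ((f \o shift (x + t *: v)) (u *: v) - f (x + t *: v))).
  by apply/funext => u /=; rewrite [u *: 1]mulr1 scalerDl addrCA.
have D t : is_derive t (1:R) (fun t => f (x + t *: v)) ('D_v f (x + t *: v)).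
  split; last by rewrite /derive E.
  by have := df (x + t *: v); rewrite /derivable E.
have [|c ca] := @MVT R (fun t => f (x + t *: v)) (fun t => 'D_v f (x + t *: v)) 0 a a0 (fun t _ => D t).
  by apply: derivable_within_continuous => t _; have [] := D t.
by rewrite scale0r addr0 subr0 => Ec; exists c.
Qed.

(** Difference quotients of a test function converge pointwise by definition of
    the derivative; by the mean value theorem they are bounded by the maximum
    of the derivative, and they vanish outside a fixed cube. *)
Lemma test_sderiv i phi : test_function phi -> sderiv i phi ('D_(e_ i) phi).
Proof.
move=> tp; have [k Hk] := test_cube tp.
have td := test_partial i tp; have [k' Hk'] := test_cube td.
have [B HB] := test_bounded td.
have dphi y : derivable phi y (e_ i) by exact: (test_smooth tp [::]).2.
split; [exact: test_L2|exact: test_L2|].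
apply: (@dominated_cvg_nrm _ _ _ _ _ _ (fun x => (B + B) * \1_(cube (k%:R + k'%:R + 1) : set V) x)).
- by move=> n; apply: L2_diffq; exact: test_L2.
- exact: test_L2.
- exact: L2_cube.
- move=> x; have /cvg_ex[l cl] := dphi x.
  have <- : l = 'D_(e_ i) phi x by apply/esym; exact: cvg_lim.
  have hn : (2^-1 : R) ^+ n @[n --> \oo] --> (0 : R)^'.
    move=> A A0; have := cvg_half_expn A0.
    apply: (@filterS _ \oo _ (fun n => (2^-1 : R) ^+ n != 0 -> A (2^-1 ^+ n))) => n.
    by apply; rewrite expf_neq0// invr_eq0.
  rewrite (_ : (fun n => diffq i n phi x) = (fun t : R => t^-1 *:
     ((phi \o shift x) (t *: e_ i) - phi x)) \o (fun n => 2^-1 ^+ n)).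
    exact: cvg_comp hn cl.
  by apply/funext => n; rewrite /diffq /dyshift /shiftf !fctE /= exprVn invrK [_ + x]addrC.
- move=> n x.
  have h0 : 0 < (2^-1 : R) ^+ n by rewrite exprn_gt0 ?invr_gt0.
  have [xk|xk] := pselect (cube (k%:R + k'%:R + 1) x).
    rewrite indicE mem_set// mulr1.
    have [c _ E] := mvt_dir x h0 dphi.
    have -> : diffq i n phi x = 'D_(e_ i) phi (x + c *: e_ i).
      rewrite /diffq /dyshift /shiftf !fctE E [_ *: _]mulrC -mulrA [_ * 2 ^+ n]mulrC.
      by rewrite two_half mulr1.
    apply: le_trans (ler_normB _ _) _; apply: le_trans (lerD (HB _) (HB _)) _.
    exact: ler_norm.
  rewrite indicE memNset// mulr0 normr0.
  have far (y : V) : (forall j, `|y ord0 j - x ord0 j| <= 1) -> phi y = 0 /\ 'D_(e_ i) phi y = 0.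
    move=> yx; split; [apply: Hk|apply: Hk'] => yk; apply: xk => j;
    have := yk j; have := yx j; rewrite /= !in_itv/= -!ltr_norml;
    have := ler_normB (y ord0 j) (y ord0 j - x ord0 j); rewrite opprB addrCA subrr addr0;
    have := ler0n R k; have := ler0n R k'; lra.
  have [p0 d0] : phi x = 0 /\ 'D_(e_ i) phi x = 0.
    by apply: far => j; rewrite subrr normr0.
  have [p1 _] : phi (x + 2^-1 ^+ n *: e_ i) = 0 /\ 'D_(e_ i) phi (x + 2^-1 ^+ n *: e_ i) = 0.
    apply: far => j; rewrite !mxE addrAC subrr add0r eqxx/=.
    have h1 : (2^-1 : R) ^+ n <= 1 by rewrite exprn_ile1 ?invr_ge0// invf_le1 ?ler1n.
    rewrite normrM (ger0_norm (ltW h0)) normr_nat.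
    by case: (_ == _); rewrite ?mulr1// mulr0.
  by rewrite /diffq /dyshift /shiftf !fctE p0 d0 p1 !subr0 scaler0 normr0.
Qed.

End test_functions.

(** * A smooth function that vanishes on a half-line *)

Section flat.
Context {R : realType}.

(** For k = 0 this is exp (- 1 / x) continued by zero; its derivatives are
    combinations of the functions with larger k. *)
Definition flat k (x : R) : R :=
  if 0 < x then x^-1 ^+ k * expR (- x^-1) else 0.

(** With y = 1 / x, the exponential of y exceeds y^(k+2) / (k+2)!.  A bound by a
    multiple of x^2 gives differentiability at zero. *)
Lemma flat_bound k x : `|flat k x| <= (k.+2)`!%:R * x ^+ 2.
Proof.
rewrite /flat; case: ifPn => [x0|_]; last by rewrite normr0 mulr_ge0 ?sqr_ge0.
have y0 : 0 < x^-1 by rewrite invr_gt0.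
rewrite ger0_norm; last by rewrite mulr_ge0 ?exprn_ge0 ?expR_ge0// ltW.
have := @expR_ge1Dxn R x^-1 k.+1 (ltW y0).
rewrite expRN; have E0 := expR_gt0 x^-1.
move=> H; rewrite ler_pdivrMr//.
have F0 : 0 < (k.+2)`!%:R :> R by rewrite ltr0n fact_gt0.
have {}H : x^-1 ^+ k.+2 <= (k.+2)`!%:R * expR x^-1.
  rewrite mulrC -ler_pdivrMr//; apply: le_trans H; rewrite lerDr//.
have -> : x^-1 ^+ k = x ^+ 2 * x^-1 ^+ k.+2.
  rewrite !exprS; field. lra.
rewrite (_ : _ * x ^+ 2 * _ = x ^+ 2 * ((k.+2)`!%:R * expR x^-1)); last by ring.
by apply: ler_wpM2l => //; exact: sqr_ge0.
Qed.

Lemma flat_ge0_le1 x : 0 <= flat 0 x <= 1.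
Proof.
rewrite /flat; case: ifPn => [x0|_]; last by rewrite lexx ler01.
by rewrite expr0 mul1r expR_ge0 -expR0 ler_expR oppr_le0 invr_ge0 ltW.
Qed.

Lemma flat0 k x : x <= 0 -> flat k x = 0.
Proof. by move=> x0; rewrite /flat ltNge x0. Qed.

Lemma is_derive_flat k (x : R) :
  is_derive x 1 (flat k) (flat k.+2 x - k%:R * flat k.+1 x).
Proof.
have [x0|x0|->] := ltgtP x 0.
- rewrite !flat0 ?(ltW x0)// mulr0 subr0.
  apply: (@near_eq_is_derive _ _ _ (cst (0 : R))).
  near=> y; rewrite flat0//; near: y; exact: lt_le_nbhsl.
- have xn0 : x != 0 by rewrite gt_eqF.
  have D1 : is_derive x (1:R) (fun y : R => y^-1) (- x ^- 2 *: 1).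
    exact: (@is_deriveV R id x 1 1 xn0).
  have D2 := is_deriveX k D1.
  have D1' := is_deriveN D1.
  have D3 := is_derive1_comp (g := - (fun y : R => y^-1)) (is_derive_expR _) D1'.
  have D4 := is_deriveM D2 D3.
  have E : \near x, (((fun y : R => y^-1) ^+ k) * (expR \o (- (fun y : R => y^-1)))) x = flat k x.
    by apply: filterS (lt_nbhsr x0) => y y0; rewrite /flat y0 !fctE.
  apply: is_derive_eq (near_eq_is_derive E D4) _.
  rewrite /flat x0 /GRing.scale/= !fctE mulr1.
  case: k {D2 D4 E} => [|k] /=; first by rewrite !expr0 !expr1; field.
  by rewrite !exprS; field.
- rewrite !flat0// mulr0 subr0.
  have H : (fun h : R => h^-1 *: ((flat k \o shift 0) (h *: 1) - flat k 0)) @ 0^' --> (0:R).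
    apply: (@cvg_to_0_linear _ _ (k.+2)`!%:R 1 ltr01) => h /andP[h0 _].
    rewrite /= addr0 [h *: 1]mulr1 (flat0 _ (lexx 0)) subr0 [h^-1 *: _]/(h^-1 * _) normrM normfV.
    rewrite mulrC ler_pdivrMr//; apply: le_trans (flat_bound _ _) _.
    by rewrite -mulrA -expr2 real_normK ?num_real.
  by split; [apply/cvg_ex; exists 0|exact: cvg_lim].
Unshelve. all: by end_near. Qed.

Lemma cvg_flat x :
  flat 0 (n.+1%:R * x) @[n --> \oo] --> (if 0 < x then 1 else 0 : R).
Proof.
case: ifPn => x0; last first.
  rewrite (_ : (fun n => _) = fun=> 0); first exact: cvg_cst.
  by apply/funext => n; rewrite flat0// pmulr_rle0// leNgt.
rewrite (_ : (fun n => _) = fun n => expR (- (n.+1%:R^-1 * x^-1))); last first.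
  by apply/funext => n; rewrite /flat mulr_gt0// expr0 mul1r invfM.
rewrite -[X in _ --> X](@expR0 R).
apply: continuous_cvg; first exact: continuous_expR.
rewrite -[X in _ --> X]oppr0 -(mul0r x^-1); apply: cvgN; apply: cvgM; last exact: cvg_cst.
exact: cvg_harmonic.
Qed.

Lemma continuous_flat k : continuous (flat k).
Proof.
move=> x; apply: differentiable_continuous; apply/derivable1_diffP.
by have [] := is_derive_flat k x.
Qed.

End flat.

(** * Test functions that approximate indicators of boxes *)

Section box_bumps.
Context {R : realType} {N : nat}.
Local Notation V := 'rV[R]_N.
Local Notation e_ i := (delta_mx 0 i : V).

(** Partial derivatives stay in this class, so its members are smooth; showing
    this for a class avoids formulas for iterated derivatives. *)
Inductive flat_poly : (V -> R) -> Prop :=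
| flat_poly_cst c : flat_poly (cst c)
| flat_poly_atom i k c a : flat_poly (fun x => flat k (c * x ord0 i + a))
| flat_polyD f g : flat_poly f -> flat_poly g -> flat_poly (f + g)
| flat_polyM f g : flat_poly f -> flat_poly g -> flat_poly (f * g).

(** Reduces a directional derivative to a derivative in one real variable. *)
Lemma is_derive_line (f : V -> R) (x v : V) (d : R) :
  is_derive (0 : R) 1 (fun t => f (x + t *: v)) d -> is_derive x v f d.
Proof.
have E : (fun u : R => u^-1 *: (((fun t => f (x + t *: v)) \o shift 0) (u *: 1) - f (x + 0 *: v))) =
    (fun u => u^-1 *: ((f \o shift x) (u *: v) - f x)).
  by apply/funext => u /=; rewrite [u *: 1]mulr1 addr0 scale0r addr0 [x + _]addrC.
by case; rewrite /derivable /derive E => H1 H2; split.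
Qed.

Lemma is_derive_flat_atom i j k c a (x : V) :
  is_derive x (e_ j) (fun x : V => flat k (c * x ord0 i + a))
   (c * (i == j)%:R * (flat k.+2 (c * x ord0 i + a) - k%:R * flat k.+1 (c * x ord0 i + a))).
Proof.
apply: is_derive_line.
pose l := c * (i == j)%:R.
have D1 : is_derive (0:R) (1:R) (fun t : R => l * t + (c * x ord0 i + a)) l.
  have D := is_deriveD (is_deriveZ l (is_derive_id (0 : R) 1))
    (is_derive_cst (c * x ord0 i + a) (0 : R) 1).
  by apply: is_derive_eq D _; rewrite addr0 [l *: 1]mulr1.
have D2 := is_derive1_comp (g := fun t : R => l * t + (c * x ord0 i + a)) (is_derive_flat k _) D1.
rewrite (_ : (fun t => _) = flat k \o (fun t : R => l * t + (c * x ord0 i + a))).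
  apply: is_derive_eq D2 _.
  by rewrite mulr0 add0r mulrC.
by apply/funext => t /=; congr flat; rewrite !mxE eqxx/= /l; ring.
Qed.

Lemma flat_poly_derive f j : flat_poly f ->
  exists2 g, flat_poly g & forall x, is_derive x (e_ j) f (g x).
Proof.
elim=> [c|i k c a|{}f g _ [f' bf df] _ [g' bg dg]|{}f g Hf [f' bf df] Hg [g' bg dg]].
- by exists (cst 0); [exact: flat_poly_cst|move=> x; exact: is_derive_cst].
- exists (cst (c * (i == j)%:R) * ((fun x => flat k.+2 (c * x ord0 i + a)) +
     cst (- k%:R) * (fun x => flat k.+1 (c * x ord0 i + a)))).
    apply: flat_polyM; first exact: flat_poly_cst.
    apply: flat_polyD; first exact: flat_poly_atom.
    by apply: flat_polyM; [exact: flat_poly_cst|exact: flat_poly_atom].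
  move=> x; apply: is_derive_eq (is_derive_flat_atom _ _ _ _ _ _) _.
  by rewrite !fctE mulNr.
- exists (f' + g'); first exact: flat_polyD.
  by move=> x; exact: (is_deriveD (df x) (dg x)).
- exists (f * g' + g * f'); first by apply: flat_polyD; exact: flat_polyM.
  by move=> x; exact: (is_deriveM (df x) (dg x)).
Qed.

Lemma flat_poly_continuous f : flat_poly f -> continuous f.
Proof.
elim=> [c|i k c a|{}f g _ cf _ cg|{}f g _ cf _ cg] x.
- exact: cst_continuous.
- change {for x, continuous (flat k \o (fun x : V => c * x ord0 i + a))}.
  apply: continuous_comp; last exact: continuous_flat.
  have cx : (fun y : V => y ord0 i) y @[y --> x] --> x ord0 i by exact: coord_continuous.
  have := cvgD (cvgM (cvg_cst c) cx) (cvg_cst a); exact.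
- by apply: continuousD; [exact: cf|exact: cg].
- by apply: continuousM; [exact: cf|exact: cg].
Qed.

Lemma flat_poly_smooth f : flat_poly f -> smooth f.
Proof.
move=> bf s.
have bs : flat_poly (partials s f).
  elim: s => //= i s /(flat_poly_derive i)[g bg dg].
  by rewrite (_ : 'D__ _ = g)//; apply/funext => x; have [] := dg x.
split; first exact: flat_poly_continuous.
by move=> i x; have [g _ /(_ x)[]] := flat_poly_derive i bs.
Qed.

(** The factor exp (- 1 / (n (x_i - a_i))) exp (- 1 / (n (b_i - x_i))) tends to 1
    inside the box when n grows, and vanishes outside. *)
Definition box_bump (a b : 'I_N -> R) n : V -> R := \prod_(i < N)
  ((fun x => flat 0 (n.+1%:R * x ord0 i + - (n.+1%:R * a i))) *
   (fun x => flat 0 (- n.+1%:R * x ord0 i + n.+1%:R * b i))).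

Lemma box_bumpE a b n x : box_bump a b n x = \prod_(i < N)
  (flat 0 (n.+1%:R * (x ord0 i - a i)) * flat 0 (n.+1%:R * (b i - x ord0 i))).
Proof.
rewrite /box_bump; elim/big_rec2 : _ => [//|i y f _ <-].
by rewrite !fctE; congr (flat _ _ * flat _ _ * _); ring.
Qed.

Lemma box_bump_le1 a b n x : 0 <= box_bump a b n x <= 1.
Proof.
rewrite box_bumpE; elim/big_ind : _ => [|y z /andP[y0 y1] /andP[z0 z1]|i _].
- by rewrite ler01 lexx.
- by rewrite mulr_ge0// mulr_ile1.
- have /andP[y0 y1] := flat_ge0_le1 (n.+1%:R * (x ord0 i - a i)).
  have /andP[z0 z1] := flat_ge0_le1 (n.+1%:R * (b i - x ord0 i)).
  by rewrite mulr_ge0// mulr_ile1.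
Qed.

Lemma box_bump_out a b n x : ~ box a b x -> box_bump a b n x = 0.
Proof.
move=> /existsNP[i]; rewrite /= in_itv/= => /negP; rewrite negb_and -!leNgt => xi.
rewrite box_bumpE (bigD1 i)//=.
case/orP: xi => xi.
  by rewrite flat0 ?mul0r// pmulr_rle0// subr_le0.
by rewrite [flat _ (_ * (b i - _))]flat0 ?mulr0 ?mul0r// pmulr_rle0// subr_le0.
Qed.

Lemma box_bump_test a b n : test_function (box_bump a b n).
Proof.
apply: (@test_of_cube _ _ _ (\sum_i (`|a i| + `|b i|))).
  apply: flat_poly_smooth; rewrite /box_bump; elim/big_ind : _ => [|f g|i _].
  - exact: (flat_poly_cst 1).
  - exact: flat_polyM.
  - by apply: flat_polyM; exact: flat_poly_atom.
move=> x xk; apply: box_bump_out => xab; apply: xk => i.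
have := xab i; rewrite /= !in_itv/= => /andP[H1 H2].
have H : `|a i| + `|b i| <= \sum_i (`|a i| + `|b i|).
  by rewrite [leRHS](bigD1 i)//= lerDl sumr_ge0// => j _; rewrite addr_ge0.
have := ler_norm (b i); have := ler_norm (- a i); rewrite normrN.
have := normr_ge0 (a i); have := normr_ge0 (b i).
by move: H H1 H2; move: (\sum_i _) => S *; apply/andP; split; lra.
Qed.

Lemma cvg_box_bump a b x : box_bump a b n x @[n --> \oo] --> (\1_(box a b) x : R).
Proof.
have [xab|xab] := pselect (box a b x); last first.
  rewrite indicE memNset// (_ : (fun n => _) = fun=> 0); first exact: cvg_cst.
  by apply/funext => n; exact: box_bump_out.
rewrite indicE mem_set//= mulr1n.
rewrite (_ : (fun n => _) = fun n => \prod_(i < N)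
  (flat 0 (n.+1%:R * (x ord0 i - a i)) * flat 0 (n.+1%:R * (b i - x ord0 i)))); last first.
  by apply/funext => n; exact: box_bumpE.
have E1 : \prod_(i < N) (1 * 1) = 1 :> R by rewrite big1// => i _; rewrite mulr1.
rewrite -[X in _ --> X]E1.
have c2 : continuous (fun z : R * R => z.1 * z.2) by exact: mul_continuous.
apply: (@cvg_big R 'I_N *%R 1 xpredT c2 nat \oo (index_enum 'I_N)
  (fun i n => flat 0 (n.+1%:R * (x ord0 i - a i)) * flat 0 (n.+1%:R * (b i - x ord0 i)))
  (fun=> 1 * 1)) => i _.
have := xab i; rewrite /= in_itv/= -(subr_gt0 (a i)) -(subr_gt0 _ (b i)) => /andP[ai bi].
apply: cvgM.
- by have := @cvg_flat R (x ord0 i - a i); rewrite ai.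
- by have := @cvg_flat R (b i - x ord0 i); rewrite bi.
Qed.

End box_bumps.

(** * Measures with a density *)

Section density.
Context d (X : measurableType d) (R : realType) (nu : {measure set X -> \bar R}).
Variables (f : X -> \bar R) (mf : measurable_fun setT f) (f0 : forall x, (0 <= f x)%E).

Definition density (A : set X) : \bar R := (\int[nu]_(x in A) f x)%E.

Let density0 : density set0 = 0%E.
Proof. by rewrite /density integral_set0. Qed.

Let density_ge0 A : (0 <= density A)%E.
Proof. by apply: integral_ge0 => x _. Qed.

Let density_sigma_additive : semi_sigma_additive density.
Proof.
move=> A mA tA mUA; rewrite /density ge0_integral_bigcup//; last first.
  by apply: measurable_funS mf.
apply: is_cvg_ereal_nneg_natsum_cond => n _ _; exact: integral_ge0.
Qed.

HB.instance Definition _ := isMeasure.Build _ _ _ density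
  density0 density_ge0 density_sigma_additive.

End density.

(** * Weak derivatives *)

Section weak_strong.
Context {R : realType} {N : nat}.
Local Notation mu := (lebesgue_rV R N).
Local Notation V := 'rV[R]_N.
Local Notation L2 := (L2 mu).
Local Notation nrm := (nrm mu).
Local Notation ip := (ip mu).
Local Notation e_ i := (delta_mx 0 i : V).
Implicit Types (f g h u phi psi : V -> R) (i j : 'I_N) (s : seq 'I_N).

Lemma ball_compact (k : R) : compact [set y : V | `|y| <= k].
Proof.
apply: bounded_closed_compact.
  exists k; split; first exact: num_real.
  by move=> M kM y /= yk; exact: le_trans (ltW kM).
apply: (@preimage_closed _ _ (@Num.norm _ V) [set z | z <= k]); last exact: closed_le.
by move=> y _; exact: norm_continuous.
Qed.

Lemma loc_integrable_box u a b : loc_integrable u ->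
  mu.-integrable (box a b) (EFin \o u).
Proof.
move=> [mU Ku].
pose k : R := \sum_i (`|a i| + `|b i|).
have mB : measurable (box a b : set V) by exact: measurable_box_itv.
have cK := @ball_compact k.
have mK := compact_measurable_rV cK.
have BK : box a b `<=` [set y : V | `|y| <= k].
  move=> x xab /=; rewrite [leLHS]/Num.norm/= mx_normrE; apply: bigmax_le => [|[j i] _].
    by rewrite /k sumr_ge0// => i _; rewrite addr_ge0.
  rewrite /= (ord1 j); have := xab i; rewrite /= in_itv/= => /andP[H1 H2].
  have H : `|a i| + `|b i| <= k by rewrite /k [leRHS](bigD1 i)//= lerDl sumr_ge0// => l _; rewrite addr_ge0.
  apply: le_trans H.
  have := ler_norm (b i); have := ler_norm (- a i); rewrite normrN.
  have := normr_ge0 (a i); have := normr_ge0 (b i).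
  by move: H1 H2 => *; rewrite ler_norml; apply/andP; split; lra.
apply/integrableP; split.
  by apply: measurable_funS (measurableT) _ _ => //; exact/measurable_EFinP.
apply: le_lt_trans (Ku _ cK); apply: ge0_subset_integral => //.
by apply/measurable_EFinP; apply: measurableT_comp => //; apply: measurable_funS mU.
Qed.

Lemma L2_loc_integrable f : L2 f -> loc_integrable f.
Proof.
move=> Lf; have [mf lf] := Lf; split=> // K cK.
have mK := compact_measurable_rV cK; have [k Kk] := compact_sub_cube cK.
have mC : measurable (cube k%:R : set V) by exact: measurable_box_itv.
(* |f| <= f^2 + 1 on a cube that contains K. *)
apply: (@le_lt_trans _ _ (\int[mu]_(x in cube k%:R) ((f x) ^+ 2)%:E + \int[mu]_(x in cube k%:R) 1)%E).
  rewrite -ge0_integralD//.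
  - apply: (@le_trans _ _ (\int[mu]_(x in K) ((f x ^+ 2)%:E + 1)%E)%E).
      apply: ge0_le_integral => //.
      - by apply/measurable_EFinP; apply: measurableT_comp => //; apply: measurable_funS mf.
      - apply/measurable_EFinP; apply: measurable_funD => //; apply: measurable_funX.
        exact: measurable_funS mf.
      - move=> x _; rewrite -EFinD lee_fin -(real_normK (num_real (f x))).
        by have := sqr_ge0 (`|f x| - 1); move: `|f x| => y; nra.
    apply: ge0_subset_integral => //.
    - apply/measurable_EFinP; apply: measurable_funD => //; apply: measurable_funX.
      exact: measurable_funS mf.
    - by move=> x _; rewrite -EFinD lee_fin addr_ge0 ?sqr_ge0.
  - by move=> x _; rewrite lee_fin sqr_ge0.
  - by apply/measurable_EFinP; apply: measurable_funX; apply: measurable_funS mf.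
rewrite lte_add_pinfty//.
- apply: le_lt_trans lf; apply: ge0_subset_integral => //.
  + exact: measurable_sqr.
  + by move=> x _; rewrite lee_fin sqr_ge0.
- by rewrite integral_cst// mul1e lebesgue_rV_box_lty.
Qed.

Lemma integrable_mul_test u phi : loc_integrable u -> test_function phi ->
  mu.-integrable setT (EFin \o (fun x => u x * phi x)).
Proof.
move=> lu tp; have [k Hk] := test_cube tp; have [B HB] := test_bounded tp.
have := loc_integrable_box (fun=> - k%:R) (fun=> k%:R) lu; rewrite -/(cube k%:R) => iu.
have mC : measurable (cube k%:R : set V) by exact: measurable_box_itv.
rewrite (_ : (EFin \o _) = (EFin \o (fun x => u x * phi x)) \_ (cube k%:R)); last first.
  apply/funext => x; rewrite /patch; case: ifPn => // /negP xk /=.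
  by rewrite Hk ?mulr0// => H; apply: xk; rewrite mem_set.
rewrite -(integrable_mkcond _ mC).
have iB := integrableZl mC B iu.
apply: (le_integrable mC _ _ iB).
  apply/measurable_EFinP; apply: measurable_funM.
    exact: measurable_funS lu.1.
  by apply: measurable_funS (test_measurable tp).
move=> x _ /=; rewrite lee_fin !normrM mulrC ler_wpM2r//.
by apply: le_trans (HB x) _; exact: ler_norm.
Qed.

(** Dominated convergence along [box_bump]. *)
Lemma integral_box_eq0 u a b : loc_integrable u ->
  (forall phi, test_function phi -> \int[mu]_x (u x * phi x) = 0) ->
  (\int[mu]_(x in box a b) (u x)%:E = 0)%E.
Proof.
move=> lu u0; have iu := loc_integrable_box a b lu.
have mB : measurable (box a b : set V) by exact: measurable_box_itv.
have mU : measurable_fun setT (EFin \o u) by apply/measurable_EFinP; exact: lu.1.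
have H1 n : measurable_fun (box a b) (fun x => (u x * box_bump a b n x)%:E).
  apply/measurable_EFinP; apply: measurable_funM; first exact: measurable_funS lu.1.
  by apply: measurable_funS (test_measurable (box_bump_test a b n)).
have H2 : \forall x \ae mu, box a b x ->
    (u x * box_bump a b n x)%:E @[n --> \oo] --> (EFin \o u) x.
  apply: aeW => x xab; apply: cvg_EFin; first exact: nearW.
  rewrite -[X in _ --> X](mulr1 (u x)); apply: cvgM; first exact: cvg_cst.
  by have := @cvg_box_bump R N a b x; rewrite indicE mem_set.
have H3 : \forall x \ae mu, forall n, box a b x ->
    (`|(u x * box_bump a b n x)%:E| <= (abse \o (EFin \o u)) x)%E.
  apply: aeW => x n _ /=; rewrite lee_fin normrM ler_piMr//.
  by have /andP[b0 b1] := box_bump_le1 a b n x; rewrite ger0_norm.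
have [_ _] := dominated_convergence mB H1 (measurable_funTS mU) H2 (integrable_abse iu) H3.
have Z n : (\int[mu]_(x in box a b) (u x * box_bump a b n x)%:E = 0)%E.
  rewrite integral_mkcond (_ : _ \_ _ = EFin \o (fun x => u x * box_bump a b n x)); last first.
    apply/funext => x; rewrite /patch; case: ifPn => // /negP xk /=.
    by rewrite box_bump_out ?mulr0// => H; apply: xk; rewrite mem_set.
  have tp := box_bump_test a b n.
  have := u0 _ tp; rewrite /Rintegral.
  have := integrable_fin_num measurableT (integrable_mul_test lu tp).
  by rewrite /comp; case: (\int[mu]_x _)%E => //= r _ ->.
move=> H; have := cvg_lim (@ereal_hausdorff R) H => <-.
under eq_fun do rewrite Z.
exact: lim_cst.
Qed.

(** The fundamental lemma of the calculus of variations.  The positive and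
    negative parts of u are densities of two measures that agree on every box,
    hence on the set where u is positive and on its complement; on each of
    these one of the two densities vanishes. *)
Lemma integral_test_eq0 u : loc_integrable u ->
  (forall phi, test_function phi -> \int[mu]_x (u x * phi x) = 0) ->
  ae_eq mu setT u (cst 0).
Proof.
move=> lu u0.
have mU : measurable_fun setT (EFin \o u) by apply/measurable_EFinP; exact: lu.1.
have mp := measurable_funepos mU; have mq := measurable_funeneg mU.
set p := (EFin \o u)^\+%E; set q := (EFin \o u)^\-%E.
have p0 x : (0 <= p x)%E by exact: funepos_ge0.
have q0 x : (0 <= q x)%E by exact: funeneg_ge0.
have pfin a b : (\int[mu]_(x in box a b) p x)%E \is a fin_num.
  exact: (integrable_pos_fin_num (measurable_box_itv a b) (loc_integrable_box a b lu)).
have qfin a b : (\int[mu]_(x in box a b) q x)%E \is a fin_num.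
  exact: (integrable_neg_fin_num (measurable_box_itv a b) (loc_integrable_box a b lu)).
have pq a b : (\int[mu]_(x in box a b) p x = \int[mu]_(x in box a b) q x)%E.
  have := integral_box_eq0 a b lu u0; rewrite (integralE _ _ (EFin \o u)) -/p -/q.
  have := pfin a b; have := qfin a b.
  case: (\int[mu]_(x in box a b) p x)%E => // r _.
  by case: (\int[mu]_(x in box a b) q x)%E => // r' _ [] /eqP; rewrite subr_eq0 => /eqP ->.
have PQ A : measurable A -> (\int[mu]_(x in A) p x = \int[mu]_(x in A) q x)%E.
  apply: (@measure_unique_boxes _ _ (density mu p : {measure set _ -> \bar R})
     (density mu q : {measure set _ -> \bar R})) => //.
  by move=> k; rewrite /= /density ltey_eq pfin.
(* The negative part vanishes on A and the positive part outside A. *)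
pose A : set V := [set x | 0 < u x].
have mA : measurable A.
  by rewrite -[A]setTI; apply: measurable_fun_ltr => //; exact: lu.1.
have P0 : (\int[mu]_(x in A) p x = 0)%E.
  rewrite PQ//; apply: integral0_eq => x Ax; rewrite /q funenegE /=.
  by rewrite maxEle lee_fin oppr_le0 ltW.
have Q0 : (\int[mu]_(x in ~` A) q x = 0)%E.
  rewrite -PQ; last exact: measurableC.
  apply: integral0_eq => x /negP; rewrite -leNgt => Ax; rewrite /p funeposE /=.
  by rewrite maxEle lee_fin Ax.
have : (\int[mu]_x `|(EFin \o u) x| = 0)%E.
  rewrite -(setUv A) ge0_integral_setU//; last 3 first.
  - exact: measurableC.
  - by rewrite setUv; apply: measurableT_comp.
  - by apply/disj_setPS; rewrite setICr.
  rewrite (eq_integral p); last first.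
    move=> x; rewrite inE => Ax; rewrite /p funeposE /= gtr0_norm// maxEle lee_fin.
    by rewrite leNgt Ax.
  rewrite P0 add0e (eq_integral q)// => x; rewrite inE => /negP; rewrite -leNgt => Ax.
  by rewrite /q funenegE /= ler0_norm// maxEle lee_fin oppr_le0; case: ltgtP Ax => //= ->; rewrite oppr0.
move=> /(ae_eq_integral_abs mu measurableT mU).
by apply: filterS => x /(_ I) /= H _; case: H.
Qed.

Lemma is_weak_unique s f g g' : is_weak_partials s f g -> is_weak_partials s f g' ->
  ae_eq mu setT g g'.
Proof.
move=> [lf lg fg] [_ lg' fg'].
have lD : loc_integrable (g - g').
  split; first by apply: measurable_funB; [exact: lg.1|exact: lg'.1].
  move=> K cK; have mK := compact_measurable_rV cK.
  have mg := measurable_funTS lg.1 : measurable_fun K g.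
  have mg' := measurable_funTS lg'.1 : measurable_fun K g'.
  apply: (@le_lt_trans _ _ (\int[mu]_(x in K) `|g x|%:E + \int[mu]_(x in K) `|g' x|%:E)%E).
    rewrite -ge0_integralD//; try by apply/measurable_EFinP; exact: measurableT_comp.
    apply: ge0_le_integral => //.
    - by apply/measurable_EFinP; apply: measurableT_comp => //; apply: measurable_funB.
    - by apply/measurable_EFinP; apply: measurable_funD; apply: measurableT_comp.
    - by move=> x _; rewrite lee_fin; exact: ler_normB.
  by rewrite lte_add_pinfty//; [exact: lg.2|exact: lg'.2].
have : ae_eq mu setT (g - g') (cst 0).
  apply: integral_test_eq0 lD _ => phi tp.
  under eq_Rintegral do rewrite !fctE mulrBl.
  rewrite RintegralB//; [|exact: integrable_mul_test..].
  have := fg phi tp; rewrite fg'//; have s0 : (-1) ^+ size s != 0 :> R by rewrite signr_eq0.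
  by move=> /(mulfI s0) ->; rewrite subrr.
by apply: filterS => x /(_ I) /= /eqP; rewrite subr_eq0 => /eqP H _.
Qed.

Lemma weak_partials_ae s f g : is_weak_partials s f g ->
  measurable_fun setT (weak_partials s f) /\ ae_eq mu setT g (weak_partials s f).
Proof.
move=> wg; have w : is_weak_partials s f (weak_partials s f).
  exact: (xgetI (fun=> 0) wg).
split; first by have [_ [mw _] _] := w.
exact: is_weak_unique wg w.
Qed.

(** Integration by parts against a test function, which is itself strongly
    differentiable. *)
Lemma sderiv_weak i f g : sderiv i f g -> is_weak_partials [:: i] f g.
Proof.
move=> fg; have [Lf Lg _] := fg; split; [exact: L2_loc_integrable|exact: L2_loc_integrable|].
move=> phi tp; rewrite /= expr1 mulN1r.
have := sderiv_ibp fg (test_sderiv i tp); rewrite /ip => ->; exact/esym/opprK.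
Qed.

(** The inner derivative of a test function is again a test function, so weak
    derivatives compose without exchanging the order of differentiations. *)
Lemma is_weak_cat i j f g h : is_weak_partials [:: i] f g -> is_weak_partials [:: j] g h ->
  is_weak_partials [:: i; j] f h.
Proof.
move=> [lf lg fg] [_ lh gh]; split=> // phi tp.
have := fg _ (test_partial j tp); have := gh phi tp; rewrite /= => -> ->.
by rewrite expr1 expr2 mulrA.
Qed.

End weak_strong.

(** * Interpolation between orders of differentiation *)

Section iterated_differences.
Context {R : realType} {N : nat}.
Local Notation mu := (lebesgue_rV R N).
Local Notation V := 'rV[R]_N.
Local Notation L2 := (L2 mu).
Local Notation nrm := (nrm mu).
Local Notation ip := (ip mu).
Local Notation e_ i := (delta_mx 0 i : V).
Implicit Types (f g h u w phi psi : V -> R) (i j : 'I_N) (n : nat)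
  (s t : seq ('I_N * nat)) (r : seq 'I_N).

(** A word lists the direction and the dyadic scale of each difference
    quotient. *)
Definition diffqs s f : V -> R := foldr (fun p g => diffq p.1 p.2 g) f s.

Lemma L2_diffqs s f : L2 f -> L2 (diffqs s f).
Proof. by move=> Lf; elim: s => //= p s; exact: L2_diffq. Qed.

Lemma diffqsB s f g : diffqs s (f - g) = diffqs s f - diffqs s g.
Proof. by elim: s => //= p s ->; rewrite diffqB. Qed.

Lemma diffqs_diffq s i n f : diffqs s (diffq i n f) = diffq i n (diffqs s f).
Proof. by elim: s => //= p s ->; rewrite diffqC. Qed.

Lemma diffqs_cat s t f : diffqs (s ++ t) f = diffqs s (diffqs t f).
Proof. exact: foldr_cat. Qed.

Lemma diffqsC s t f : diffqs s (diffqs t f) = diffqs t (diffqs s f).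
Proof. by elim: s => //= p s ->; rewrite diffqs_diffq. Qed.

(** Difference quotients commute.  Sorting words by direction makes it possible
    to compare them with the partial derivatives of a multi-index without
    exchanging derivatives. *)
Lemma diffqs_perm s t f : perm_eq s t -> diffqs s f = diffqs t f.
Proof.
move=> st; apply: (catCA_perm_ind (P := fun t => diffqs s f = diffqs t f)) st _ => //.
by move=> s1 s2 s3 ->; rewrite !diffqs_cat diffqsC.
Qed.

Lemma partials_diffq r i n phi : smooth phi ->
  partials r (diffq i n phi) = diffq i n (partials r phi).
Proof.
move=> sp; have st := smooth_shiftf (2^-1 ^+ n *: e_ i) sp.
rewrite /diffq /dyshift partialsZ; last first.
  by apply: smoothD => //; rewrite -scaleN1r; exact: smoothZ.
rewrite partialsD//; last by rewrite -scaleN1r; exact: smoothZ.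
by rewrite -scaleN1r partialsZ// partials_shiftf scaleN1r.
Qed.

(** Difference quotients are traded for derivatives one at a time, each of them
    acting on a test function. *)
Lemma nrm_diffqs_partials s phi : test_function phi ->
  nrm (diffqs s phi) <= nrm (partials (map fst s) phi).
Proof.
elim: s phi => //= -[i n] s IH phi tp /=.
rewrite -diffqs_diffq; apply: le_trans (IH _ (test_diffq i n tp)) _.
rewrite partials_diffq; last exact: test_smooth.
by apply: sderiv_nrm_diffq; apply: test_sderiv; exact: test_partials.
Qed.

(** Refining all steps to a common finer one increases the norm. *)
Lemma nrm_diffqs_le s n f : L2 f -> {in s, forall p, (p.2 <= n)%N} ->
  nrm (diffqs s f) <= nrm (diffqs [seq (p.1, n) | p <- s] f).
Proof.
elim: s f => //= -[i k] s IH f Lf H /=.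
have kn : (k <= n)%N by apply: (H (i, k)); exact: mem_head.
apply: le_trans (nrm_diffq_le i (L2_diffqs s Lf) kn) _.
rewrite -!diffqs_diffq; apply: IH; first exact: L2_diffq.
by move=> p ps; apply: H; rewrite in_cons ps orbT.
Qed.

Lemma word_steps_le s : {in s, forall p, (p.2 <= \max_(q <- s) q.2)%N}.
Proof. by move=> p ps; rewrite (big_rem p)//= leq_maxl. Qed.

(** Were the maximum over words of length at most k larger than K, no word could
    reach it: words of length 0 and k are bounded by K, and at an intermediate
    word the square of the norm is at most the maximum times the norm at the
    tail of the word, which is below the maximum by induction. *)
Lemma interpolation_steps n k K f : L2 f -> nrm f <= K ->
  (forall r, size r = k -> nrm (diffqs [seq (i, n) | i <- r] f) <= K) ->
  forall r, (size r <= k)%N -> nrm (diffqs [seq (i, n) | i <- r] f) <= K.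
Proof.
move=> Lf f0 fk.
pose F r := nrm (diffqs [seq (i, n) | i <- r] f).
pose b0 : {bseq k of 'I_N} := [bseq].
pose bm := [arg max_(b > b0) F b]%O.
have HM (r : seq 'I_N) : (size r <= k)%N -> F r <= F bm.
  move=> rk; rewrite /bm; case: arg_maxP => // b _ Hb.
  exact: (Hb (Bseq rk)).
suff : F bm <= K by move=> H r rk; exact: le_trans (HM r rk) H.
rewrite leNgt; apply/negP => KM.
(* A word of intermediate length is interpolated between its tail and the word
   that repeats its first direction. *)
have lt r : (size r <= k)%N -> F r < F bm.
  elim: r => [|i r IH] rk; first exact: le_lt_trans KM.
  have [rk'|] := eqVneq (size (i :: r)) k; first by apply: le_lt_trans KM; exact: fk.
  move=> rk'; have {}rk' : (size (i :: i :: r) <= k)%N by rewrite /= ltn_neqAle rk' rk.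
  have /IH Fr : (size r <= k)%N by exact: ltnW.
  rewrite -(@ltr_pXn2r _ 2)// ?nnegrE ?nrm_ge0//.
  apply: le_lt_trans (nrm_diffq_interp i n (L2_diffqs _ Lf)) _.
  apply: (@le_lt_trans _ _ (F r * F bm)).
    by apply: ler_wpM2l; [exact: nrm_ge0|exact: (HM [:: i, i & r])].
  by rewrite expr2 ltr_pM2r//; apply: le_lt_trans Fr; exact: nrm_ge0.
by have := lt bm (size_bseq bm); rewrite ltxx.
Qed.

Lemma interpolation k K f : L2 f -> nrm f <= K ->
  (forall s, size s = k -> nrm (diffqs s f) <= K) ->
  forall s, (size s <= k)%N -> nrm (diffqs s f) <= K.
Proof.
move=> Lf f0 fk s sk.
apply: le_trans (nrm_diffqs_le Lf (@word_steps_le s)) _.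
rewrite (_ : map _ s = [seq (i, \max_(q <- s) q.2)%N | i <- map fst s]); last by rewrite -map_comp.
apply: (interpolation_steps (k := k)) => //; last by rewrite size_map.
by move=> r rk; apply: fk; rewrite size_map.
Qed.

(** What survives differentiation: derivatives of functions of this kind are of
    the same kind with k lowered by one, and at order one the approximation by
    test functions still gives a derivative. *)
Definition diffq_approximable k f := [/\ L2 f,
  exists K, forall s, (size s <= k)%N -> nrm (diffqs s f) <= K &
  forall e, 0 < e -> exists2 psi, test_function psi &
    forall s, size s = k -> nrm (diffqs s (psi - f)) <= e].

(** The Sobolev space H^k, with strong derivatives. *)
Fixpoint Sobolev k f : Prop :=
  if k is k'.+1 then L2 f /\ forall i, exists g, sderiv i f g /\ Sobolev k' g else L2 f.

Lemma cvg_nrm_diffqs s (f_ : nat -> V -> R) f : (forall n, L2 (f_ n)) -> L2 f ->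
  nrm (f_ n - f) @[n --> \oo] --> (0 : R) ->
  nrm (diffqs s (f_ n) - diffqs s f) @[n --> \oo] --> (0 : R).
Proof.
move=> Lf_ Lf cf; elim: s => //= -[i m] s IH /=.
have LD n : L2 (diffqs s (f_ n) - diffqs s f) by apply: L2B; exact: L2_diffqs.
apply: (@cvg_le_dist _ _ (fun n => 2 ^+ m * 2 * nrm (diffqs s (f_ n) - diffqs s f))).
  move=> n; rewrite subr0 ger0_norm ?nrm_ge0// -diffqB /diffq nrmZ; last first.
    by apply: L2B => //; exact: L2_dyshift.
  rewrite ger0_norm ?exprn_ge0// -mulrA; apply: ler_wpM2l; first by rewrite exprn_ge0.
  apply: le_trans (nrmB (L2_dyshift _ _ (LD n)) (LD n)) _.
  by rewrite nrm_dyshift//; lra.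
by rewrite -[X in _ --> X](mulr0 (2 ^+ m * 2)); apply: cvgM => //; exact: cvg_cst.
Qed.

(** Uniformity of the approximation in the step allows the Cauchy property to be
    copied from a test function. *)
Lemma diffq_cauchy_approximable i f : diffq_approximable 1 f -> forall e, 0 < e ->
  exists n0 : nat, forall a b, (n0 <= a)%N -> (n0 <= b)%N ->
    nrm (diffq i a f - diffq i b f) <= e.
Proof.
case=> Lf _ Hpsi e e0.
have e4 : 0 < e / 4 by rewrite divr_gt0.
have [psi tpsi Hp] := Hpsi _ e4.
have [Lp Ld /cvgr0_norm_le/(_ _ e4)[n0 _ H0]] := test_sderiv i tpsi.
have near n : (n0 <= n)%N -> nrm (diffq i n f - 'D_(e_ i) psi) <= e / 2.
  move=> n0n; have := H0 n n0n; rewrite ger0_norm ?nrm_ge0// => H1.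
  have := Hp [:: (i, n)] erefl; rewrite /= diffqB => H2.
  have Lf' := L2_diffq i n Lf; have Lp' := L2_diffq i n Lp.
  have := nrm_triangle Lf' Lp' Ld; rewrite (nrm_distC Lf' Lp').
  by move: H1 H2; lra.
exists n0 => a b /near Ha /near Hb.
have La := L2_diffq i a Lf; have Lb := L2_diffq i b Lf.
have := nrm_triangle La Ld Lb; rewrite (nrm_distC Ld Lb).
by move: Ha Hb; lra.
Qed.

(** Telescoping of [diffq_step]. *)
Lemma diffq_cauchy_bounded i K f : L2 f ->
  (forall n, nrm (diffq i n (diffq i n f)) <= K) -> forall e, 0 < e ->
  exists n0 : nat, forall a b, (n0 <= a)%N -> (n0 <= b)%N ->
    nrm (diffq i a f - diffq i b f) <= e.
Proof.
move=> Lf HK e e0.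
have LD n := L2_diffq i n Lf.
have K0 : 0 <= K by apply: le_trans (HK 0%N); exact: nrm_ge0.
(* A bound that telescopes in k makes the induction immediate. *)
have step n k : nrm (diffq i n f - diffq i (n + k) f) <= K * (2^-1 ^+ n - 2^-1 ^+ (n + k)).
  elim: k => [|k IH]; first by rewrite addn0 !subrr nrm0 mulr0.
  apply: le_trans (nrm_triangle (LD n) (LD (n + k)%N) (LD _)) _.
  rewrite addnS diffq_step nrmZ; last by do 2!apply: L2_diffq.
  have h0 : 0 <= (2^-1 : R) ^+ (n + k) by rewrite exprn_ge0 ?invr_ge0.
  have H := HK (n + k).+1.
  rewrite ger0_norm ?divr_ge0// exprS.
  move: IH H h0; move: (2^-1 ^+ (n + k)) (nrm (diffq i _ (diffq i _ _))) => h z IH Hz h0.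
  have : h * z <= h * K by apply: ler_wpM2l.
  have : 0 <= h * K by apply: mulr_ge0.
  by move: IH; rewrite !mulrBr; move: (nrm _) (K * _) => *; lra.
have {}step n a : (n <= a)%N -> nrm (diffq i n f - diffq i a f) <= K * 2^-1 ^+ n.
  move=> na; rewrite -(subnKC na); apply: le_trans (step n _) _.
  by apply: ler_wpM2l => //; rewrite lerBlDr lerDl exprn_ge0 ?invr_ge0.
have [n0 _ H0] : \forall n \near \oo, `|K * 2^-1 ^+ n| <= e / 2.
  have e2 : 0 < e / 2 by rewrite divr_gt0.
  have : K * 2^-1 ^+ n @[n --> \oo] --> (0 : R).
    by rewrite -[X in _ --> X](mulr0 K); apply: cvgM; [exact: cvg_cst|exact: cvg_half_expn].
  by move=> /cvgr0_norm_le /(_ _ e2).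
have {}H0 := le_trans (ler_norm _) (H0 n0 (leqnn n0)).
exists n0 => a b /step Ha /step Hb.
have := nrm_triangle (LD a) (LD n0) (LD b); rewrite (nrm_distC (LD a) (LD n0)).
by move: Ha Hb H0; lra.
Qed.

(** Both conditions pass to the limit g because a word of difference quotients
    is continuous on L^2; the test functions that approximate g are the
    derivatives of those that approximate f. *)
Lemma diffq_approximable_sderiv k f i : diffq_approximable k.+1 f ->
  exists g, sderiv i f g /\ (if k is k'.+1 then diffq_approximable k g else L2 g).
Proof.
move=> af; have [Lf [K HK] Hpsi] := af.
have Ldiffq n : L2 (diffq i n f) by exact: L2_diffq.
have [g [Lg cg]] : exists g, L2 g /\ nrm (diffq i n f - g) @[n --> \oo] --> (0 : R).
  apply: (L2_complete Ldiffq); case: k af HK {Hpsi} => [af _|k _ HK].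
    exact: diffq_cauchy_approximable.
  by apply: (@diffq_cauchy_bounded _ K) => // n; exact: (HK [:: (i, n); (i, n)]).
have fg : sderiv i f g by split.
exists g; split=> //.
case: k HK Hpsi {af} => [//|k] HK Hpsi; split=> //.
- exists K => s sk.
  have c := cvg_nrm (fun n => L2_diffqs s (Ldiffq n)) (L2_diffqs s Lg) (cvg_nrm_diffqs s Ldiffq Lg cg).
  apply: (cvgr_to_le c); apply: nearW => n.
  have := HK (rcons s (i, n)); rewrite size_rcons ltnS => /(_ sk).
  by rewrite /diffqs foldr_rcons.
- move=> e e0; have [psi tpsi Hp] := Hpsi e e0.
  exists ('D_(e_ i) psi); first exact: test_partial.
  move=> s sk; have [Lp Ld cp] := sderivB (test_sderiv i tpsi) fg.
  have LD n : L2 (diffq i n (psi - f)) by exact: L2_diffq.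
  have c := cvg_nrm (fun n => L2_diffqs s (LD n)) (L2_diffqs s Ld) (cvg_nrm_diffqs s LD Ld cp).
  apply: (cvgr_to_le c); apply: nearW => n.
  have := Hp (rcons s (i, n)); rewrite size_rcons sk => /(_ erefl).
  by rewrite /diffqs foldr_rcons.
Qed.

Lemma diffq_approximable_Sobolev k f : diffq_approximable k f -> Sobolev k f.
Proof.
elim: k f => [|k IH] f; first by case.
move=> af; split; first by case: af.
move=> i; have [g [fg]] := diffq_approximable_sderiv i af.
by case: k IH af => [|k] IH af ag; exists g; split=> //; exact: IH.
Qed.

End iterated_differences.

(** * From the homogeneous Sobolev space to difference quotients *)

Section membership.
Context {R : realType} {N : nat}.
Local Notation mu := (lebesgue_rV R N).
Local Notation V := 'rV[R]_N.
Local Notation L2 := (L2 mu).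
Local Notation nrm := (nrm mu).
Local Notation ip := (ip mu).
Local Notation e_ i := (delta_mx 0 i : V).
Implicit Types (f g h u w phi psi : V -> R) (i j : 'I_N) (n : nat)
  (s t : seq ('I_N * nat)) (r : seq 'I_N).

Lemma poweR_Lnorm2 f : L2 f -> ('N[mu]_2%:E[EFin \o f] `^ 2 = (nrm f ^+ 2)%:E)%E.
Proof.
move=> Lf; rewrite poweR_Lnorm// nrm_sqrE//; apply: eq_integral => x _ /=.
by rewrite powR_mulrn// real_normK ?num_real.
Qed.

Lemma nrm_le_Dnorm k (alpha : {ffun 'I_N -> 'I_k.+1}) phi : test_function phi ->
  multi_order alpha == k -> ((nrm (multi_partial alpha phi))%:E <= Dnorm k phi)%E.
Proof.
move=> tp ak; have tm : test_function (multi_partial alpha phi) by exact: test_partials.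
rewrite /Dnorm.
have -> : ((nrm (multi_partial alpha phi))%:E =
   ('N[mu]_2%:E[EFin \o multi_partial alpha phi] `^ 2) `^ 2^-1)%E.
  rewrite poweR_Lnorm2; last exact: test_L2.
  by rewrite poweR12_sqrt ?lee_fin ?sqr_ge0//= sqrtr_sqr ger0_norm ?nrm_ge0.
apply: gt0_ler_poweR; first by rewrite invr_ge0.
- by rewrite in_itv/= poweR_ge0 leey.
- by rewrite in_itv/= leey andbT; apply: sume_ge0 => a _; rewrite poweR_ge0.
- rewrite [leRHS](bigD1 alpha)//= leeDl//.
  by apply: sume_ge0 => a _; rewrite poweR_ge0.
Qed.

(** The multi-index counts the occurrences of each direction. *)
Lemma word_multi_index k r : size r = k -> exists alpha : {ffun 'I_N -> 'I_k.+1},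
  multi_order alpha == k /\ perm_eq r (flatten [seq nseq (alpha i) i | i <- enum 'I_N]).
Proof.
move=> rk; exists [ffun i => inord (count_mem i r)].
have E i : nat_of_ord ([ffun i => inord (count_mem i r)] i : 'I_k.+1) = count_mem i r.
  by rewrite ffunE inordK// ltnS -rk count_size.
have P : perm_eq r (flatten [seq nseq (count_mem i r) i | i <- enum 'I_N]).
  apply/allP => x _ /=; apply/eqP; rewrite count_flatten -map_comp sumnE big_map big_enum/=.
  rewrite (bigD1 x)//= count_nseq /= eqxx mul1n big1 ?addn0// => i ix.
  by rewrite /= count_nseq /= (negbTE ix).
have P' : perm_eq r (flatten [seq nseq ([ffun i => inord (count_mem i r)] i : 'I_k.+1) i | i <- enum 'I_N]).
  by under eq_map do rewrite E.
split=> //; rewrite /multi_order -[X in _ == X]rk (perm_size P') size_flatten /shape -map_comp.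
rewrite sumnE big_map big_enum/=; apply/eqP; apply: eq_bigr => i _.
by rewrite size_nseq.
Qed.

(** After a common refinement of the steps the word can be reordered so that its
    directions follow the order used by [multi_partial]. *)
Lemma nrm_diffqs_multi_partial s phi : test_function phi ->
  exists alpha : {ffun 'I_N -> 'I_(size s).+1}, multi_order alpha == size s /\
    nrm (diffqs s phi) <= nrm (multi_partial alpha phi).
Proof.
move=> tp; pose n := (\max_(q <- s) q.2)%N.
have [|alpha [ak ap]] := @word_multi_index (size s) (map fst s); first by rewrite size_map.
exists alpha; split=> //.
apply: le_trans (nrm_diffqs_le (test_L2 tp) (@word_steps_le _ s)) _.
set t := flatten _ in ap.
have -> : [seq (p.1, n) | p <- s] = [seq (i, n) | i <- map fst s] by rewrite -map_comp.
rewrite (diffqs_perm _ (perm_map _ ap)).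
apply: le_trans (nrm_diffqs_partials _ tp) _.
by rewrite -map_comp map_id_in.
Qed.

Lemma nrm_diffqs_Dnorm s phi : test_function phi ->
  ((nrm (diffqs s phi))%:E <= Dnorm (size s) phi)%E.
Proof.
move=> tp; have [alpha [ak H]] := nrm_diffqs_multi_partial s tp.
by apply: le_trans (nrm_le_Dnorm tp ak); rewrite lee_fin.
Qed.

Lemma ae_shiftf v (Q : V -> Prop) : (\forall x \ae mu, Q x) -> \forall x \ae mu, Q (x + v).
Proof.
case=> A [mA A0 QA]; exists (translate v @^-1` A); split.
- by rewrite -[X in measurable X]setTI; exact: measurable_translate.
- by have := lebesgue_rV_translate v mA; rewrite /pushforward A0.
- by move=> x /= Qx; exact: QA.
Qed.

(** Translates of null sets are null sets. *)
Lemma ae_cvg_diffqs s (f_ : nat -> V -> R) f :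
  (\forall x \ae mu, f_ n x @[n --> \oo] --> f x) ->
  (\forall x \ae mu, diffqs s (f_ n) x @[n --> \oo] --> diffqs s f x).
Proof.
move=> H; elim: s => //= -[i m] s IH /=.
have IH' := ae_shiftf (2^-1 ^+ m *: e_ i) IH.
apply: filterS2 IH IH' => x Hx Hx'; rewrite /diffq /dyshift /shiftf !fctE.
by apply: cvgM; [exact: cvg_cst|exact: cvgB].
Qed.

(** A subsequence with L^p distance at most 2^-k has summable p-th powers of the
    distance; [1 <= p] is what makes these powers smaller than the distance. *)
Lemma Lnorm_cvg_ae (p : R) (f_ : nat -> V -> R) f : 1 <= p ->
  (forall n, measurable_fun setT (f_ n)) -> measurable_fun setT f ->
  ('N[mu]_(p%:E)[EFin \o (f_ n \- f)%R])%E @[n --> \oo] --> 0%E ->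
  exists m : nat -> nat, (forall k, (k <= m k)%N) /\
    \forall x \ae mu, f_ (m k) x @[k --> \oo] --> f x.
Proof.
move=> p1 mf_ mf cf.
have p0 : 0 < p by exact: lt_le_trans p1.
have Hk k : exists n, (k <= n)%N /\ ('N[mu]_(p%:E)[EFin \o (f_ n \- f)%R] <= (2^-1 ^+ k)%:E)%E.
  have k0 : 0 < (2^-1 : R) ^+ k by rewrite exprn_gt0 ?invr_gt0.
  have /fine_cvgP[fin /cvgr0_norm_le /(_ _ k0) cv] := cf.
  near \oo => n; exists n; split; first by near: n; exists k.
  have nf : 'N[mu]_(p%:E)[EFin \o (f_ n \- f)%R]%E \is a fin_num by near: n.
  rewrite -(fineK nf) lee_fin; apply: le_trans (ler_norm _) _.
  by near: n.
have [m Hm] := choice Hk.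
exists m; split; first by move=> k; have [] := Hm k.
have : \forall x \ae mu, `|f_ (m k) x - f x| `^ p @[k --> \oo] --> (0 : R).
  apply: (@ae_cvg0_summable _ _ _ mu (fun k x => `|f_ (m k) x - f x| `^ p) (fun k => 2^-1 ^+ k)).
  - move=> k; apply: (measurableT_comp (measurable_powR _)).
    by apply: measurableT_comp => //; exact: measurable_funB.
  - by move=> k x; exact: powR_ge0.
  - move=> k; have [_ Hmk] := Hm k.
    have k0 : 0 < (2^-1 : R) ^+ k by rewrite exprn_gt0 ?invr_gt0.
    have := @poweR_Lnorm _ _ _ mu (EFin \o (f_ (m k) \- f)) p.
    rewrite gt_eqF// => /(_ isT) /= <-.
    apply: (@le_trans _ _ ((2^-1 ^+ k)%:E `^ p)%E).
      apply: gt0_ler_poweR => //; first exact: ltW.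
      - by rewrite in_itv/= Lnorm_ge0 leey.
      - by rewrite in_itv/= leey andbT lee_fin ltW.
    rewrite poweR_EFin lee_fin -[leRHS]powRr1 ?(ltW k0)//.
    apply: ger_powR => //; rewrite k0/=.
    by rewrite exprn_ile1 ?invr_ge0// invf_le1 ?ler1n.
  - exact: sum_half_lty.
apply: filterS => x Hx.
apply/cvgrPdist_lt => e e0.
have ep : 0 < e `^ p by rewrite powR_gt0.
have := Hx => /cvgr0_norm_lt /(_ _ ep); apply: filterS => k.
rewrite ger0_norm ?powR_ge0// distrC.
apply: contraTT; rewrite -!leNgt => ek; apply: ge0_ler_powR => //; exact: ltW.
Unshelve. all: by end_near. Qed.

(** The exponent of the Lebesgue space in which phi_n converges to u matters only
    through the existence of an almost everywhere convergent subsequence: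
    the difference quotients of phi_n - phi_l are bounded by their seminorm,
    and Fatou's lemma lets l tend to infinity. *)
Lemma Dspace_diffq_approximable k u : (2 * k < N)%N -> Dspace k u -> L2 u -> diffq_approximable k u.
Proof.
move=> kN [mU [phi [tphi Cphi cphi]]] Lu.
have H1 : 1 <= (2 * N)%:R / (N - 2 * k)%:R :> R.
  have n0 : 0 < (N - 2 * k)%:R :> R by rewrite ltr0n subn_gt0.
  rewrite ler_pdivlMr// mul1r ler_nat (leq_trans (leq_subr _ _))//.
  by rewrite leq_pmull.
have [m [km cm]] := Lnorm_cvg_ae H1 (fun n => test_measurable (tphi n)) mU cphi.
have top e : 0 < e -> exists n0 : nat, forall n, (n0 <= n)%N ->
    forall s, size s = k -> nrm (diffqs s (phi n - u)) <= e.
  move=> e0; have [n0 H0] := Cphi e e0; exists n0 => n nn s sk.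
  apply: (@fatou_nrm _ _ _ mu (fun l => diffqs s (phi n - phi (m l))) _ e _ _ _ _).2.
  - by move=> l; apply: L2_diffqs; apply: L2B; exact: test_L2.
  - by have [] : L2 (diffqs s (phi n - u)) by apply: L2_diffqs; apply: L2B => //; exact: test_L2.
  - exists n0 => // l nl; rewrite -lee_fin.
    apply: le_trans (nrm_diffqs_Dnorm s (testB (tphi n) (tphi (m l)))) _.
    rewrite sk; apply: ltW; apply: (H0 n (m l) nn).
    exact: leq_trans nl (km l).
  - apply: ae_cvg_diffqs; apply: filterS cm => x cx; rewrite !fctE.
    by apply: cvgB => //; exact: cvg_cst.
split=> //.
- have [n0 H0] := top 1 ltr01.
  have tp := tphi n0; have Lp := test_L2 tp.
  (* One bound for all words: there are finitely many multi-indices. *)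
  pose B : R := \sum_(alpha : {ffun 'I_N -> 'I_k.+1}) nrm (multi_partial alpha (phi n0)).
  have bound s : size s = k -> nrm (diffqs s (phi n0)) <= B.
    move=> sk; rewrite /B -sk.
    have [alpha [_ /le_trans]] := nrm_diffqs_multi_partial s tp; apply.
    by rewrite [leRHS](bigD1 alpha)//= lerDl sumr_ge0// => a _; exact: nrm_ge0.
  exists (Num.max (nrm u) (B + 1)); apply: interpolation => //.
    by rewrite le_max lexx.
  move=> s sk; rewrite le_max; apply/orP; right.
  rewrite (_ : u = phi n0 - (phi n0 - u)); last by rewrite opprB addrC subrK.
  rewrite diffqsB; apply: le_trans (nrmB _ _) _; try by apply: L2_diffqs => //; exact: L2B.
  by apply: lerD; [exact: bound|exact: H0].
- move=> e /top[n0 H0]; exists (phi n0); first exact: tphi.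
  by move=> s; exact: H0.
Qed.

End membership.

(** * The Laplacian has no square-integrable eigenfunction *)

Section eigenfunctions.
Context {R : realType} {N : nat}.
Local Notation mu := (lebesgue_rV R N).
Local Notation V := 'rV[R]_N.
Local Notation L2 := (L2 mu).
Local Notation nrm := (nrm mu).
Local Notation ip := (ip mu).
Local Notation e_ i := (delta_mx 0 i : V).
Implicit Types (f g h u w psi a b : V -> R) (i j : 'I_N) (n : nat) (k : R).

Lemma L2_mul a f (B : R) : measurable_fun setT a -> (forall x, `|a x| <= B) -> L2 f ->
  L2 (a * f) /\ nrm (a * f) <= B * nrm f.
Proof.
move=> ma aB Lf; have B0 : 0 <= B by exact: le_trans (aB 0).
have mB : measurable_fun setT (a * f) by apply: measurable_funM => //; exact: Lf.1.
have le : (\int[mu]_x ((a * f) x ^+ 2)%:E <= ((B * nrm f) ^+ 2)%:E)%E.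
  have -> : ((B * nrm f) ^+ 2)%:E = (\int[mu]_x (((B *: f) x) ^+ 2)%:E)%E.
    by rewrite -nrm_sqrE ?nrmZ ?(ger0_norm B0)//; exact: L2Z.
  apply: ge0_le_integral => //.
  - by move=> x _; rewrite lee_fin sqr_ge0.
  - exact: measurable_sqr.
  - by apply: measurable_sqr; exact: (L2Z B Lf).1.
  - move=> x _; rewrite lee_fin !fctE -(real_normK (num_real (a x * f x))).
    rewrite -[leRHS](real_normK (num_real _)) ler_pXn2r ?nnegrE// !normrM.
    by rewrite (ger0_norm B0) ler_wpM2r.
have LM : L2 (a * f) by split=> //; apply: le_lt_trans le _; rewrite ltry.
split=> //; rewrite -(@ler_pXn2r _ 2)// ?nnegrE ?mulr_ge0 ?nrm_ge0//.
by rewrite -lee_fin nrm_sqrE.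
Qed.

(** Leibniz rule for a bounded Lipschitz multiplier whose difference quotients
    converge uniformly. *)
Lemma sderiv_mul j a b f g (C : R) : sderiv j f g ->
  measurable_fun setT a -> measurable_fun setT b ->
  (forall x, `|a x| <= C) -> (forall x, `|b x| <= C) ->
  (forall n x, `|dyshift j n a x - a x| <= C * 2^-1 ^+ n) ->
  (forall n x, `|diffq j n a x - b x| <= C * 2^-1 ^+ n) ->
  sderiv j (a * f) (a * g + b * f).
Proof.
move=> [Lf Lg fg] ma mb aC bC ta Da.
have [La _] := L2_mul ma aC Lf; have [Lag _] := L2_mul ma aC Lg.
have [Lbf _] := L2_mul mb bC Lf.
split=> //; first exact: L2D.
have mta n : measurable_fun setT (dyshift j n a) by exact: measurable_shiftf.
(* Discrete Leibniz rule: only the first factor is translated. *)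
have E n : diffq j n (a * f) - (a * g + b * f) = (dyshift j n a) * (diffq j n f - g) +
    ((dyshift j n a - a) * g + (diffq j n a - b) * f).
  by apply/funext => x; rewrite /diffq /dyshift /shiftf !fctE /GRing.scale/=; ring.
have LD n : L2 (diffq j n f - g) by apply: L2B => //; exact: L2_diffq.
apply: (@cvg_le_dist _ _ (fun n => C * nrm (diffq j n f - g) +
   (C * 2^-1 ^+ n * nrm g + C * 2^-1 ^+ n * nrm f))).
  move=> n; rewrite subr0 ger0_norm ?nrm_ge0// E.
  have [L1 H1] := L2_mul (mta n) (fun x => aC _) (LD n).
  have [L2_ H2] := L2_mul (measurable_funB (mta n) ma) (ta n) Lg.
  have m3 : measurable_fun setT (diffq j n a - b).
    apply: measurable_funB => //; apply: measurable_funM => //; exact: measurable_funB.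
  have [L3 H3] := L2_mul m3 (Da n) Lf.
  apply: le_trans (nrmD L1 (L2D L2_ L3)) _; apply: lerD => //.
  by apply: le_trans (nrmD L2_ L3) _; apply: lerD.
have h0 c : C * 2^-1 ^+ n * c @[n --> \oo] --> (0 : R).
  rewrite -[X in _ --> X](mul0r c) -(mulr0 C); apply: cvgM; last exact: cvg_cst.
  by apply: cvgM; [exact: cvg_cst|exact: cvg_half_expn].
rewrite -[X in _ --> X](addr0 0); apply: cvgD.
  by rewrite -[X in _ --> X](mulr0 C); apply: cvgM => //; exact: cvg_cst.
by rewrite -[X in _ --> X](addr0 0); apply: cvgD; exact: h0.
Qed.

Lemma mvt_bound (F dF : R -> R) (s t B : R) : 0 <= t ->
  (forall x : R, is_derive x (1 : R) F (dF x)) -> (forall x, s < x < s + t -> `|dF x| <= B) ->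
  `|F (s + t) - F s| <= B * t.
Proof.
rewrite le_eqVlt => /predU1P[<-|t0] dFx dB; first by rewrite addr0 subrr normr0 mulr0.
have st : s < s + t by rewrite ltrDl.
have [|c cst ->] := MVT st (fun x _ => dFx x).
  by apply: derivable_within_continuous => x _; have [] := dFx x.
have -> : s + t - s = t by rewrite addrC addKr.
by rewrite normrM (gtr0_norm t0) ler_pM2r//; apply: dB; move: cst; rewrite in_itv.
Qed.

Lemma sin_lipschitz (s t : R) : 0 <= t -> `|sin (s + t) - sin s| <= t.
Proof.
move=> t0; rewrite -[leRHS]mul1r; apply: (mvt_bound (dF := cos)) => // x _.
exact: cos_max.
Qed.

Lemma cos_lipschitz (s t : R) : 0 <= t -> `|cos (s + t) - cos s| <= t.
Proof.
move=> t0; rewrite -[leRHS]mul1r; apply: (mvt_bound (dF := fun x => - sin x)) => // x _.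
by rewrite normrN; exact: sin_max.
Qed.

(** The derivative of sin x - x cos s on [s, s + t] is at most t. *)
Lemma sin_taylor1 (s t : R) : 0 <= t -> `|sin (s + t) - sin s - t * cos s| <= t ^+ 2.
Proof.
move=> t0.
have D x : is_derive x (1:R) (fun x : R => sin x - x * cos s) (cos x - cos s).
  have D := is_deriveB (is_derive_sin x) (is_deriveZ (cos s) (is_derive_id x 1)).
  have D' : is_derive x (1:R) (fun x : R => sin x - cos s * x) (cos x - cos s).
    by apply: is_derive_eq D _; rewrite [_ *: 1]mulr1.
  by rewrite (_ : (fun x => _) = fun x => sin x - cos s * x)//;
    apply/funext => y; rewrite (mulrC y).
have := @mvt_bound _ _ s t t t0 D.
have -> : sin (s + t) - (s + t) * cos s - (sin s - s * cos s) = sin (s + t) - sin s - t * cos s by ring.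
apply=> x /andP[sx xt]; have xs : 0 <= x - s by rewrite subr_ge0 ltW.
have := cos_lipschitz s xs; rewrite (addrC s) subrK => /le_trans; apply.
by rewrite lerBlDr addrC ltW.
Qed.

Definition sin_coord i k : V -> R := fun x => sin (k * x ord0 i).
Definition cos_coord i k : V -> R := fun x => cos (k * x ord0 i).

Lemma measurable_cos_coord i k : measurable_fun setT (cos_coord i k).
Proof.
apply: (@measurableT_comp _ _ _ _ _ _ cos _ (fun x : V => k * x ord0 i)).
  by apply: continuous_measurable_fun; exact: continuous_cos.
by apply: measurable_funM => //; exact: measurable_rV_coord.
Qed.

Lemma L2_cosM i k f : L2 f -> L2 (cos_coord i k * f).
Proof. by move=> Lf; have [] := L2_mul (measurable_cos_coord i k) (fun x => cos_max _) Lf. Qed.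

Lemma measurable_sin_coord i k : measurable_fun setT (sin_coord i k).
Proof.
apply: (@measurableT_comp _ _ _ _ _ _ sin _ (fun x : V => k * x ord0 i)).
  by apply: continuous_measurable_fun; exact: continuous_sin.
by apply: measurable_funM => //; exact: measurable_rV_coord.
Qed.

Lemma L2_sinM i k f : L2 f -> L2 (sin_coord i k * f).
Proof. by move=> Lf; have [] := L2_mul (measurable_sin_coord i k) (fun x => sin_max _) Lf. Qed.

Lemma sderiv_sin i j k f g : 0 <= k -> sderiv j f g ->
  sderiv j (sin_coord i k * f) (sin_coord i k * g + ((j == i)%:R * k) *: (cos_coord i k * f)).
Proof.
move=> k0 fg.
have ms := measurable_sin_coord i k; have mc := measurable_cos_coord i k.
have k2 := sqr_ge0 k.
have h0 n : 0 <= (2^-1 : R) ^+ n by rewrite exprn_ge0 ?invr_ge0.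
have E n (x : V) : k * (x + 2^-1 ^+ n *: e_ j) ord0 i = k * x ord0 i + (j == i)%:R * k * 2^-1 ^+ n.
  by rewrite !mxE eqxx/= eq_sym; ring.
have -> : ((j == i)%:R * k) *: (cos_coord i k * f) = (((j == i)%:R * k) *: cos_coord i k) * f.
  by apply/funext => x; rewrite !fctE /GRing.scale/= mulrA.
have d0 : 0 <= (j == i)%:R * k by rewrite mulr_ge0.
have d1 : (j == i)%:R * k <= k by case: (j == i); rewrite ?mul1r ?mul0r.
move: d0 d1 E; set d := (j == i)%:R * k => d0 d1 E.
have dh n : 0 <= d * 2^-1 ^+ n by rewrite mulr_ge0.
apply: (@sderiv_mul j _ _ f g (1 + k + k ^+ 2)) => //.
- by apply: measurable_funM => //; exact: measurable_cst.
- by move=> x; apply: le_trans (sin_max _) _; lra.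
- move=> x; rewrite !fctE normrM (ger0_norm d0).
  apply: (@le_trans _ _ (d * 1)); last by lra.
  by apply: ler_wpM2l => //; exact: cos_max.
- move=> n x; rewrite /dyshift /shiftf /sin_coord E.
  apply: le_trans (sin_lipschitz _ (dh n)) _.
  by apply: ler_wpM2r => //; lra.
- move=> n x; rewrite /diffq /dyshift /shiftf !fctE /sin_coord /cos_coord E.
  move: (k * x ord0 i) => y.
  have := sin_taylor1 y (dh n).
  have tw : (2 : R) ^+ n * 2^-1 ^+ n = 1 by exact: two_half.
  set z := sin _ - sin y => H.
  have -> : 2 ^+ n *: z - d *: cos y = 2 ^+ n * (z - d * 2^-1 ^+ n * cos y).
    by rewrite mulrBr [in RHS](mulrC d) !mulrA tw mul1r.
  rewrite normrM (ger0_norm (exprn_ge0 _ _))//.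
  apply: le_trans (ler_wpM2l _ H) _; first by rewrite exprn_ge0.
  have -> : 2 ^+ n * (d * 2^-1 ^+ n) ^+ 2 = d ^+ 2 * 2^-1 ^+ n * (2 ^+ n * 2^-1 ^+ n) by ring.
  rewrite tw mulr1; apply: ler_wpM2r => //.
  have : d ^+ 2 <= k ^+ 2 by rewrite ler_pXn2r ?nnegrE.
  by lra.
Qed.

Lemma cvg_cosM i f : L2 f ->
  nrm (cos_coord i (2^-1 ^+ n) * f - f) @[n --> \oo] --> (0 : R).
Proof.
move=> Lf; apply: (@dominated_cvg_nrm _ _ _ mu _ _ (2 *: f)) => //.
- by move=> n; exact: L2_cosM.
- exact: L2Z.
- move=> x; rewrite -[X in _ --> X](mul1r (f x)); apply: cvgM; last exact: cvg_cst.
  have c0 : 2^-1 ^+ n * x ord0 i @[n --> \oo] --> (0 : R).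
    by rewrite -(mul0r (x ord0 i)); apply: cvgM; [exact: cvg_half_expn|exact: cvg_cst].
  rewrite -[X in _ --> X](@cos0 R); apply: continuous_cvg; last exact: c0.
  exact: continuous_cos.
- move=> n x; rewrite !fctE normrM (ger0_norm (ler0n R 2)).
  apply: le_trans (ler_normB _ _) _; rewrite normrM mulr2n mulrDl mul1r lerD2r.
  by rewrite ler_piMl//; exact: cos_max.
Qed.

Lemma ip_mulC a f g : ip f (a * g) = ip g (a * f).
Proof. by apply: eq_Rintegral => x _; rewrite !fctE; ring. Qed.

(** The equation Delta u = - lam u, with its strong derivatives u1 and u2 made
    explicit. *)
Definition eigen (lam : R) u (u1 u2 : 'I_N -> V -> R) :=
  [/\ forall j, sderiv j u (u1 j), forall j, sderiv j (u1 j) (u2 j) &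
      nrm (\sum_j u2 j + lam *: u) = 0].

Lemma eigen_L2 lam u (u1 u2 : 'I_N -> V -> R) : 'I_N -> eigen lam u u1 u2 ->
  [/\ L2 u, forall j, L2 (u1 j) & forall j, L2 (u2 j)].
Proof.
move=> i [H1 H2 _]; split; first by have [] := H1 i.
- by move=> j; have [] := H1 j.
- by move=> j; have [] := H2 j.
Qed.

(** The equation has constant coefficients, hence is invariant under
    translations. *)
Lemma eigen_diffq lam u (u1 u2 : 'I_N -> V -> R) i n : eigen lam u u1 u2 ->
  eigen lam (diffq i n u) (fun j => diffq i n (u1 j)) (fun j => diffq i n (u2 j)).
Proof.
move=> H; have [Lu Lu1 Lu2] := eigen_L2 i H; case: H => H1 H2 H3.
split=> [j|j|]; [exact: sderiv_diffq|exact: sderiv_diffq|].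
have LS : L2 (\sum_j u2 j + lam *: u) by apply: L2D; [exact: L2_sum|exact: L2Z].
rewrite (_ : _ + _ = diffq i n (\sum_j u2 j + lam *: u)).
  rewrite /diffq nrmZ; last by apply: L2B => //; exact: L2_dyshift.
  apply/eqP; rewrite mulf_eq0; apply/orP; right; rewrite eq_le nrm_ge0 andbT.
  by apply: le_trans (nrmB (L2_dyshift _ _ LS) LS) _; rewrite nrm_dyshift// H3 addr0.
rewrite diffqD diffqZ; congr (_ + _).
elim/big_rec2 : _ => [|j x y _ ->]; last by rewrite diffqD.
by rewrite /diffq subr0 scaler0.
Qed.

Lemma eigen_ip lam u (u1 u2 : 'I_N -> V -> R) h : 'I_N -> eigen lam u u1 u2 -> L2 h ->
  \sum_j ip (u2 j) h = - lam * ip u h.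
Proof.
move=> i H Lh; have [Lu Lu1 Lu2] := eigen_L2 i H; case: H => _ _ H3.
have LS := L2_sum (index_enum 'I_N) Lu2.
have := ip_nrm0 (L2D LS (L2Z lam Lu)) Lh H3.
rewrite ipDl//; last exact: L2Z.
rewrite ipZl// ip_suml// => /eqP; rewrite addr_eq0 => /eqP ->; by rewrite mulNr.
Qed.

(** Symmetry of the Laplacian tested on sin (k x_i) u and w: the terms in
    sin (k x_i) cancel, and those in cos (k x_i) come from the derivative of
    the multiplier in direction i. *)
Lemma eigen_cos lam u (u1 u2 : 'I_N -> V -> R) w (w1 w2 : 'I_N -> V -> R) i k : 0 < k ->
  eigen lam u u1 u2 -> eigen lam w w1 w2 ->
  ip (cos_coord i k * u) (w1 i) = ip (cos_coord i k * u1 i) w.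
Proof.
move=> k0 Hu Hw.
have [Lu Lu1 Lu2] := eigen_L2 i Hu; have [Lw Lw1 Lw2] := eigen_L2 i Hw.
have [su1 su2 _] := Hu; have [sw1 sw2 _] := Hw.
have Su j := sderiv_sin i (ltW k0) (su1 j); have Sw j := sderiv_sin i (ltW k0) (sw1 j).
have LS h : L2 h -> L2 (sin_coord i k * h) by exact: L2_sinM.
have LC h : L2 h -> L2 (cos_coord i k * h) by exact: L2_cosM.
(* Both sides are - lam times the integral of sin (k x_i) u w. *)
have E : \sum_j ip (u2 j) (sin_coord i k * w) = \sum_j ip (w2 j) (sin_coord i k * u).
  by rewrite (eigen_ip i Hu (LS _ Lw)) (eigen_ip i Hw (LS _ Lu)) ip_mulC.
have Eu : \sum_j ip (u2 j) (sin_coord i k * w) =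
    - (\sum_j ip (w1 j) (sin_coord i k * u1 j)) - k * ip (u1 i) (cos_coord i k * w).
  rewrite (eq_bigr (fun j => - ip (w1 j) (sin_coord i k * u1 j)
      - (j == i)%:R * (k * ip (u1 j) (cos_coord i k * w)))); last first.
    move=> j _; rewrite (sderiv_ibp (su2 j) (Sw j)).
    rewrite (ipDr (LS _ (Lw1 j)) (L2Z _ (LC _ Lw)) (Lu1 j)) (ipZr _ (LC _ Lw) (Lu1 j)).
    by rewrite [ip (u1 j) (sin_coord _ _ * _)]ip_mulC; ring.
  rewrite big_split/= sumrN; congr (_ + _).
  rewrite (bigD1 i)//= eqxx mul1r big1 ?addr0// => j /negbTE ->.
  by rewrite mul0r oppr0.
have Ew : \sum_j ip (w2 j) (sin_coord i k * u) =
    - (\sum_j ip (w1 j) (sin_coord i k * u1 j)) - k * ip (w1 i) (cos_coord i k * u).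
  rewrite (eq_bigr (fun j => - ip (w1 j) (sin_coord i k * u1 j)
      - (j == i)%:R * (k * ip (w1 j) (cos_coord i k * u)))); last first.
    move=> j _; rewrite (sderiv_ibp (sw2 j) (Su j)).
    by rewrite (ipDr (LS _ (Lu1 j)) (L2Z _ (LC _ Lu)) (Lw1 j)) (ipZr _ (LC _ Lu) (Lw1 j)); ring.
  rewrite big_split/= sumrN; congr (_ + _).
  rewrite (bigD1 i)//= eqxx mul1r big1 ?addr0// => j /negbTE ->.
  by rewrite mul0r oppr0.
have kE : k * ip (u1 i) (cos_coord i k * w) = k * ip (w1 i) (cos_coord i k * u).
  by move: E; rewrite Eu Ew; lra.
rewrite (ipC _ _ (w1 i)) (ipC _ _ w) (ip_mulC _ w).
by apply/esym/(mulfI (lt0r_neq0 k0)).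
Qed.

Arguments cvg_cosM : clear implicits.

(** Letting k tend to 0 in [eigen_cos] shows that the i-th derivative of u is
    orthogonal to all functions with the same eigenvalue, in particular to the
    difference quotients of u, hence to their limit, which is itself.  Once
    that derivative vanishes, the same multipliers show that u is orthogonal to
    itself. *)
Lemma eigen_eq0 lam u (u1 u2 : 'I_N -> V -> R) : 'I_N -> eigen lam u u1 u2 -> ip u u = 0.
Proof.
move=> i Hu.
have [Lu Lu1 Lu2] := eigen_L2 i Hu; have [su1 su2 _] := Hu.
have h0 n : 0 < (2^-1 : R) ^+ n by rewrite exprn_gt0 ?invr_gt0.
(* Integration by parts gives the opposite of the limit of [eigen_cos]. *)
have orth w (w1 w2 : 'I_N -> V -> R) : eigen lam w w1 w2 -> ip (u1 i) w = 0.
  move=> Hw; have [Lw Lw1 _] := eigen_L2 i Hw; have [sw1 _ _] := Hw.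
  have c1 : ip (cos_coord i (2^-1 ^+ n) * u) (w1 i) @[n --> \oo] --> ip u (w1 i).
    by apply: cvg_ipl => // [n|]; [exact: L2_cosM|exact: (cvg_cosM i u Lu)].
  have c2 : ip (cos_coord i (2^-1 ^+ n) * u1 i) w @[n --> \oo] --> ip (u1 i) w.
    by apply: cvg_ipl => // [n|]; [exact: L2_cosM|exact: (cvg_cosM i (u1 i) (Lu1 i))].
  have E : ip u (w1 i) = ip (u1 i) w.
    rewrite -(cvg_lim _ c1)// -(cvg_lim _ c2)//.
    rewrite (_ : (fun n => _) = fun n => ip (cos_coord i (2^-1 ^+ n) * u1 i) w)//.
    by apply/funext => n; exact: (eigen_cos i (h0 n) Hu Hw).
  by have := sderiv_ibp (su1 i) (sw1 i); rewrite E => H; lra.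
have u10 : nrm (u1 i) = 0.
  have c : ip (diffq i n u) (u1 i) @[n --> \oo] --> ip (u1 i) (u1 i).
    by apply: cvg_ipl => // [n|]; [exact: L2_diffq|have [] := su1 i].
  have : ip (u1 i) (u1 i) = 0.
    rewrite -(cvg_lim _ c)// (_ : (fun n => _) = fun=> 0) ?lim_cst//.
    by apply/funext => n; rewrite ipC; exact: orth (eigen_diffq i n Hu).
  by rewrite /nrm => ->; rewrite sqrtr0.
have c : ip (cos_coord i (2^-1 ^+ n) * u) u @[n --> \oo] --> ip u u.
  by apply: cvg_ipl => // [n|]; [exact: L2_cosM|exact: (cvg_cosM i u Lu)].
rewrite -(cvg_lim _ c)// (_ : (fun n => _) = fun=> 0) ?lim_cst//.
apply/funext => n; have k0 := h0 n; move: k0; set k := 2^-1 ^+ n => k0.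
have S := sderiv_sin i (ltW k0) (su1 i); rewrite eqxx mul1r in S.
have [Lsu Lsu' _] := S.
have := sderiv_ibp S (su1 i).
have Z h : L2 h -> ip (u1 i) h = 0 by move=> Lh; exact: ip_nrm0.
rewrite (ipC _ _ (u1 i)) Z// oppr0 ipDl//; last 2 first.
- exact: L2_sinM.
- by apply: L2Z; exact: L2_cosM.
rewrite ipZl//; last exact: L2_cosM.
rewrite (ipC _ _ u) ip_mulC Z// add0r => /eqP; rewrite mulf_eq0 gt_eqF//= => /eqP.
by [].
Qed.

End eigenfunctions.

(** * Strict inequalities along log-convex sequences *)

Section real_chain.
Context {R : realType}.

(** If a_m^(m+1) < a_(m+1)^m and a_(m+1)^2 <= a_m a_(m+2), raise the second
    inequality to the power m + 1, bound a_m^(m+1) by the first one, and cancel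
    a_(m+1)^m. *)
Lemma log_convex_strict (a : nat -> R) (m : nat) : (1 <= m)%N ->
  (forall k, 0 <= a k) -> a 1%N ^+ 2 < a 2%N ->
  (forall k, (2 <= k <= m)%N -> a k ^+ 2 <= a k.-1 * a k.+1) ->
  a m ^+ m.+1 < a m.+1 ^+ m.
Proof.
move=> + a0 a12; elim: m => // -[_ _|m IH _ H].
  by rewrite expr1.
have lt : a m.+1 ^+ m.+2 < a m.+2 ^+ m.+1.
  apply: IH => // k /andP[k2 km]; apply: H; rewrite k2 (leq_trans km)//.
have := H m.+2; rewrite /= leqnn => /(_ isT) {}H.
have y0 : 0 < a m.+2.
  rewrite lt_def a0 andbT; apply: contraTneq lt => ->.
  by rewrite -leNgt expr0n/= exprn_ge0.
have z0 : 0 < a m.+3.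
  rewrite lt_def a0 andbT; apply: contraTneq H => ->.
  by rewrite mulr0 -ltNge exprn_gt0.
have x0 : 0 < a m.+1.
  rewrite lt_def a0 andbT; apply: contraTneq H => ->.
  by rewrite mul0r -ltNge exprn_gt0.
have {}H : (a m.+2 ^+ 2) ^+ m.+2 <= (a m.+1 * a m.+3) ^+ m.+2.
  by rewrite ler_pXn2r// nnegrE ?sqr_ge0// mulr_ge0.
(* Multiplying by a_(m+2)^(m+1) completes the left side to a power of a_(m+2)^2. *)
rewrite -(@ltr_pM2l _ (a m.+2 ^+ m.+1)) ?exprn_gt0//.
rewrite -exprD (_ : m.+1 + m.+3 = 2 * m.+2)%N; last first.
  by rewrite mul2n -addnn !addSn !addnS.
rewrite exprM; apply: le_lt_trans H _.
by rewrite exprMn ltr_pM2r ?exprn_gt0.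
Qed.

(** Both sides are the roots of order m (m + 1) of the two given powers. *)
Lemma powR_root_lt (x y : R) (m : nat) : (1 <= m)%N -> 0 <= x -> 0 <= y ->
  x ^+ m.+1 < y ^+ m -> x `^ m%:R^-1 < y `^ m.+1%:R^-1.
Proof.
move=> m1 x0 y0 xy.
have m0 : m%:R != 0 :> R by rewrite pnatr_eq0 -lt0n.
have mS0 : m.+1%:R != 0 :> R by rewrite pnatr_eq0.
have e (z : R) (p q : nat) : 0 <= z -> p%:R != 0 :> R -> q%:R != 0 :> R ->
    z `^ p%:R^-1 = (z ^+ q) `^ (p%:R * q%:R)^-1.
  move=> z0 p0 q0; rewrite -powR_mulrn// -powRrM; congr (_ `^ _); field.
  by rewrite p0 q0.
rewrite (e x m m.+1)// (e y m.+1 m)// (mulrC m.+1%:R).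
apply: gt0_ltr_powR; rewrite ?nnegrE ?exprn_ge0//.
by rewrite invr_gt0 mulr_gt0// lt0r ?m0 ?mS0 ler0n.
Qed.

End real_chain.

(** * Green identities and log-convexity of the energies *)

Section sobolev.
Context {R : realType} {N : nat}.
Local Notation mu := (lebesgue_rV R N).
Local Notation V := 'rV[R]_N.
Local Notation L2 := (L2 mu).
Local Notation nrm := (nrm mu).
Local Notation ip := (ip mu).
Local Notation e_ i := (delta_mx 0 i : V).
Local Notation wp i f := (weak_partials [:: i] f).
Local Notation lap f := (weak_laplacian f).
Implicit Types (f g h u v : V -> R) (i j : 'I_N) (k l : nat).

Lemma weak_partials_L2 s f g : L2 g -> is_weak_partials s f g ->
  L2 (weak_partials s f) /\ nrm (g - weak_partials s f) = 0.
Proof.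
move=> Lg /weak_partials_ae[mw ag]; have Lw := ae_eq_L2 Lg mw ag.
by split=> //; exact: ae_eq_nrm0.
Qed.

(** The representative chosen by [weak_partials] equals the strong derivative
    almost everywhere, so it is one. *)
Lemma sderiv_wp i f g : sderiv i f g -> sderiv i f (wp i f).
Proof.
move=> fg; have [Lf Lg _] := fg.
have [Lw gw] := weak_partials_L2 Lg (sderiv_weak fg).
by apply: sderiv_congr fg Lf Lw _ gw; rewrite subrr nrm0.
Qed.

Lemma nrm_sum0 (F : 'I_N -> V -> R) : (forall i, L2 (F i)) -> (forall i, nrm (F i) = 0) ->
  nrm (\sum_i F i) = 0.
Proof.
move=> LF F0; suff [] : L2 (\sum_i F i) /\ nrm (\sum_i F i) = 0 by [].
elim/big_ind : _ => [|f g [Lf f0] [Lg g0]|//]; first by split; [exact: L20|exact: nrm0].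
split; first exact: L2D.
by apply/eqP; rewrite eq_le nrm_ge0 andbT; apply: le_trans (nrmD Lf Lg) _; rewrite f0 g0 addr0.
Qed.

Lemma weak_laplacian_sderiv f (f1 f2 : 'I_N -> V -> R) :
  (forall i, sderiv i f (f1 i)) -> (forall i, sderiv i (f1 i) (f2 i)) ->
  L2 (lap f) /\ nrm (\sum_i f2 i - lap f) = 0.
Proof.
move=> s1 s2.
have H i : L2 (weak_partials [:: i; i] f) /\ nrm (f2 i - weak_partials [:: i; i] f) = 0.
  have [_ Lf2 _] := s2 i.
  exact: weak_partials_L2 Lf2 (is_weak_cat (sderiv_weak (s1 i)) (sderiv_weak (s2 i))).
have E : lap f = \sum_i weak_partials [:: i; i] f.
  apply/funext => x; rewrite /weak_laplacian; elim/big_rec2 : _ => // i y g _ ->.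
  by rewrite fctE.
rewrite E; split; first by apply: L2_sum => i; have [] := H i.
rewrite -sumrB; apply: nrm_sum0 => i; have [Lw w0] := H i; last exact: w0.
by apply: L2B => //; have [] := s2 i.
Qed.

Lemma Sobolev_L2 k f : Sobolev k f -> L2 f. Proof. by case: k => [|k] // []. Qed.

Lemma Sobolev_congr k f g : Sobolev k f -> L2 g -> nrm (f - g) = 0 -> Sobolev k g.
Proof.
case: k => [//|k] [Lf Hf] Lg fg; split=> // i; have [f1 [s1 H1]] := Hf i.
exists f1; split=> //; have [_ Lf1 _] := s1.
by apply: sderiv_congr s1 Lg Lf1 fg _; rewrite subrr nrm0.
Qed.

Lemma SobolevD k f g : Sobolev k f -> Sobolev k g -> Sobolev k (f + g).
Proof.
elim: k f g => [|k IH] f g; first exact: L2D.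
move=> [Lf Hf] [Lg Hg]; split; first exact: L2D.
move=> i; have [f1 [sf Hf1]] := Hf i; have [g1 [sg Hg1]] := Hg i.
by exists (f1 + g1); split; [exact: sderivD|exact: IH].
Qed.

Lemma Sobolev0 k : Sobolev k (0 : V -> R).
Proof.
elim: k => [|k IH]; first exact: L20.
split; first exact: L20.
by move=> i; exists 0; split=> //; exact: sderiv0.
Qed.

Lemma Sobolev_le k l f : (l <= k)%N -> Sobolev k f -> Sobolev l f.
Proof.
elim: k l f => [|k IH] [|l] f //; first by move=> _ /Sobolev_L2.
move=> lk [Lf Hf]; split=> // i; have [g [fg Hg]] := Hf i.
by exists g; split=> //; exact: IH.
Qed.

Lemma Sobolev_wp k f i : Sobolev k.+1 f -> sderiv i f (wp i f) /\ Sobolev k (wp i f).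
Proof.
move=> [Lf Hf]; have [g [fg Hg]] := Hf i; split; first exact: sderiv_wp fg.
have [_ Lg _] := fg; have [Lw gw] := weak_partials_L2 Lg (sderiv_weak fg).
exact: Sobolev_congr Hg Lw gw.
Qed.

Lemma Sobolev_lap k f : Sobolev k.+2 f -> [/\ Sobolev k (lap f), L2 (lap f) &
  nrm (\sum_i wp i (wp i f) - lap f) = 0].
Proof.
move=> Hf.
have H1 i := Sobolev_wp i Hf; have H2 i := Sobolev_wp i (H1 i).2.
have [Ll ll] := weak_laplacian_sderiv (fun i => (H1 i).1) (fun i => (H2 i).1).
split=> //; apply: Sobolev_congr ll => //.
elim/big_ind : _ => [|f1 f2|i _]; [exact: Sobolev0|exact: SobolevD|exact: (H2 i).2].
Qed.

Lemma Sobolev_iter_lap k l f : (2 * l <= k)%N -> Sobolev k f ->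
  Sobolev (k - 2 * l) (iter l (@weak_laplacian R N) f).
Proof.
elim: l => [|l IH] lk Hf; first by rewrite muln0 subn0.
have := IH (leq_trans _ lk) Hf; rewrite leq_mul2l leqnSn orbT => /(_ isT).
rewrite (_ : k - 2 * l = (k - 2 * l.+1).+2)%N; first by move=> /Sobolev_lap[].
by rewrite -[in LHS](subnK lk) mulnS addnA addnK addn2.
Qed.

(** Integration by parts in each direction. *)
Lemma green_grad v : Sobolev 2 v -> \sum_i ip (wp i v) (wp i v) = - ip v (lap v).
Proof.
move=> Hv; have Lv := Sobolev_L2 Hv; have [_ Ll ll] := Sobolev_lap Hv.
have H1 i := Sobolev_wp i Hv; have H2 i := Sobolev_wp i (H1 i).2.
have LW i : L2 (wp i (wp i v)) by exact: Sobolev_L2 (H2 i).2.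
have -> : ip v (lap v) = ip v (\sum_i wp i (wp i v)).
  have := ip_nrm0 (L2B (L2_sum _ LW) Ll) Lv ll.
  by rewrite ipBl//; [rewrite !(ipC _ _ v)=> /eqP; rewrite subr_eq0 => /eqP|exact: L2_sum].
rewrite ip_sumr// -sumrN; apply: eq_bigr => i _.
by rewrite (sderiv_ibp (H1 i).1 (H2 i).1).
Qed.

(** One factor of |Delta v|^2 is written as a sum of second derivatives; the
    other one is differentiated once. *)
Lemma green_lap v : Sobolev 3 v -> ip (lap v) (lap v) = - \sum_i ip (wp i v) (wp i (lap v)).
Proof.
move=> Hv; have Lv := Sobolev_L2 Hv; have [Hl Ll ll] := Sobolev_lap Hv.
have H1 i := Sobolev_wp i Hv; have H2 i := Sobolev_wp i (H1 i).2; have H3 i := Sobolev_wp i Hl.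
have LW i : L2 (wp i (wp i v)) by exact: Sobolev_L2 (H2 i).2.
have -> : ip (lap v) (lap v) = ip (\sum_i wp i (wp i v)) (lap v).
  have := ip_nrm0 (L2B (L2_sum _ LW) Ll) Ll ll.
  by rewrite ipBl//; [move=> /eqP; rewrite subr_eq0 => /eqP|exact: L2_sum].
rewrite ip_suml// -sumrN; apply: eq_bigr => i _.
exact: sderiv_ibp (H2 i).1 (H3 i).1.
Qed.

Lemma cauchy_schwarz_sum (F G : 'I_N -> V -> R) : (forall i, L2 (F i)) -> (forall i, L2 (G i)) ->
  (\sum_i ip (F i) (G i)) ^+ 2 <= (\sum_i ip (F i) (F i)) * (\sum_i ip (G i) (G i)).
Proof.
move=> LF LG; apply: discriminant_le => [||a b].
- by apply: sumr_ge0 => i _; exact: ip_ge0.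
- by apply: sumr_ge0 => i _; exact: ip_ge0.
rewrite !mulr_sumr -sumrB -big_split/=; apply: sumr_ge0 => i _.
by rewrite -ip_combination// ip_ge0.
Qed.

(** The real number whose value as an extended real is the integral of
    [nabla_sqnorm]. *)
Definition energy k u : R :=
  let v := iter k./2 (@weak_laplacian R N) u in
  if odd k then \sum_i ip (wp i v) (wp i v) else ip v v.

Lemma energy_ge0 k u : 0 <= energy k u.
Proof.
rewrite /energy; case: ifP => _; last exact: ip_ge0.
by apply: sumr_ge0 => i _; exact: ip_ge0.
Qed.

Lemma integral_nabla_sqnorm m k u : Sobolev m u -> (k <= m)%N ->
  (\int[mu]_x (nabla_sqnorm k u x)%:E = (energy k u)%:E)%E.
Proof.
move=> Hu km; rewrite /nabla_sqnorm /energy.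
have k2 : (2 * k./2 <= m)%N.
  by rewrite (leq_trans _ km)// -[leqRHS]odd_double_half mul2n leq_addl.
have := Sobolev_iter_lap k2 Hu; set v := iter _ _ _ => Hv.
case: ifP => ko; last by rewrite -(nrm_sqrE (Sobolev_L2 Hv)) nrm_sqr.
have {}Hv : Sobolev 1 v.
  apply: Sobolev_le Hv; rewrite subn_gt0 (leq_trans _ km)//.
  by rewrite -[ltnRHS]odd_double_half ko mul2n.
have LW i : L2 (wp i v) by exact: Sobolev_L2 (Sobolev_wp i Hv).2.
under eq_integral do rewrite -sumEFin.
rewrite ge0_integral_sum//.
- by rewrite -sumEFin; apply: eq_bigr => i _; rewrite -(nrm_sqrE (LW i)) nrm_sqr.
- by move=> i; apply: measurable_sqr; exact: (LW i).1.
- by move=> i x _; rewrite lee_fin sqr_ge0.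
Qed.

Lemma energy_even l u : let v := iter l (@weak_laplacian R N) u in
  energy l.*2 u = ip v v.
Proof. by rewrite /energy odd_double doubleK. Qed.

Lemma energy_odd l u : let v := iter l (@weak_laplacian R N) u in
  energy l.*2.+1 u = \sum_i ip (wp i v) (wp i v).
Proof. by rewrite /energy /= odd_double uphalf_double. Qed.

(** For odd k this is [green_grad] and for even k [green_lap], each followed by
    the Cauchy-Schwarz inequality. *)
Lemma energy_logconvex m k u : Sobolev m.+1 u -> (1 <= k <= m)%N ->
  energy k u ^+ 2 <= energy k.-1 u * energy k.+1 u.
Proof.
move=> Hu; case: k => // k /= km.
pose l := k./2; pose v := iter l (@weak_laplacian R N) u.
have lk : (2 * l <= k)%N by rewrite -[leqRHS]odd_double_half mul2n leq_addl.
have lm : (2 * l <= m.+1)%N by rewrite (leq_trans lk)// ltnW// ltnW.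
have Hv : Sobolev (m.+1 - 2 * l) v by exact: Sobolev_iter_lap lm Hu.
have kE := odd_double_half k; rewrite -/l in kE.
case ko : (odd k) kE => /= kE; rewrite -kE.
- rewrite add1n energy_odd (energy_even l.+1) (energy_odd l.+1) /= -/v.
  have {}Hv : Sobolev 3 v.
    apply: Sobolev_le Hv; rewrite leq_subRL// addn3 mul2n ltnS.
    by move: km; rewrite -kE add1n.
  rewrite green_lap// sqrrN; apply: cauchy_schwarz_sum => i.
    exact: Sobolev_L2 (Sobolev_wp i Hv).2.
  by have [Hl _ _] := Sobolev_lap Hv; exact: Sobolev_L2 (Sobolev_wp i Hl).2.
- rewrite add0n energy_odd energy_even (energy_even l.+1) /= -/v.
  have {}Hv : Sobolev 2 v.
    apply: Sobolev_le Hv; rewrite leq_subRL// addn2 mul2n ltnS.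
    by move: km; rewrite -kE add0n.
  have [_ Ll _] := Sobolev_lap Hv; have Lv := Sobolev_L2 Hv.
  rewrite green_grad// sqrrN -!nrm_sqr -exprMn -(real_normK (num_real (ip _ _))).
  by rewrite ler_pXn2r ?nnegrE ?mulr_ge0 ?nrm_ge0//; exact: cauchy_schwarz.
Qed.

(** The square of the norm of Delta u + a_1 u is a_2 - a_1^2.  If it is not
    positive, u is an eigenfunction of the Laplacian. *)
Lemma energy_strict u : Sobolev 2 u -> 'I_N -> ip u u = 1 -> energy 1 u ^+ 2 < energy 2 u.
Proof.
move=> Hu i0 u1; have Lu := Sobolev_L2 Hu; have [_ Ll ll] := Sobolev_lap Hu.
rewrite (energy_odd 0) (energy_even 1) /= green_grad// sqrrN ltNge.
apply/negP => BA; set A := - ip u (lap u).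
have H1 i := Sobolev_wp i Hu; have H2 i := Sobolev_wp i (H1 i).2.
have LS : L2 (\sum_i wp i (wp i u)) by apply: L2_sum => i; exact: Sobolev_L2 (H2 i).2.
have LA : L2 (lap u + A *: u) by apply: L2D => //; exact: L2Z.
have w0 : nrm (lap u + A *: u) = 0.
  apply/eqP; rewrite sqrtr_eq0.
  have -> : lap u + A *: u = 1 *: lap u - (- A) *: u by rewrite scale1r scaleNr opprK.
  by rewrite ip_combination// u1 (ipC _ _ u) /A; lra.
suff : eigen A u (fun i => wp i u) (fun i => wp i (wp i u)).
  by move=> /(eigen_eq0 i0); rewrite u1 => /eqP; rewrite oner_eq0.
split; [by move=> j; exact: (H1 j).1|by move=> j; exact: (H2 j).1|].
apply/eqP; rewrite eq_le nrm_ge0 andbT.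
rewrite (_ : _ + _ = (\sum_i wp i (wp i u) - lap u) + (lap u + A *: u)); last first.
  by rewrite addrA subrK.
by apply: le_trans (nrmD (L2B LS Ll) LA) _; rewrite ll w0 addr0.
Qed.

End sobolev.

(** * The interpolation inequality *)

Theorem lemma5p1 (R : realType) (m N : nat) (m_ge1 : (1 <= m)%N)
    (N_gt : (2 * m.+1 < N)%N) (u : 'rV[R]_N -> R) (Du : Dspace m.+1 u)
    (u_normalized : (\int[lebesgue_rV R N]_x (`|u x| ^+ 2)%:E = 1)%E) :
  ((\int[lebesgue_rV R N]_x (nabla_sqnorm m u x)%:E) `^ (m%:R^-1)
   < (\int[lebesgue_rV R N]_x (nabla_sqnorm m.+1 u x)%:E) `^ (m.+1%:R^-1))%E.
Proof.
have [mU _] := Du.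
have int1 : (\int[lebesgue_rV R N]_x (u x ^+ 2)%:E = 1)%E.
  rewrite -u_normalized; apply: eq_integral => x _.
  by rewrite real_normK// num_real.
have Lu : L2 (lebesgue_rV R N) u by split=> //; rewrite int1 ltry.
have ip1 : ip (lebesgue_rV R N) u u = 1.
  by have := nrm_sqrE Lu; rewrite int1 nrm_sqr => -[].
have Hu : Sobolev m.+1 u := diffq_approximable_Sobolev (Dspace_diffq_approximable N_gt Du Lu).
have i0 : 'I_N by exact: Ordinal (leq_ltn_trans (leq0n _) N_gt).
rewrite !(integral_nabla_sqnorm Hu)// !poweR_EFin lte_fin.
apply: powR_root_lt => //; try exact: energy_ge0.
apply: (@log_convex_strict _ (fun k => energy k u)) => //.
- by move=> k; exact: energy_ge0.
- by apply: energy_strict => //; exact: Sobolev_le Hu.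
- move=> k /andP[k2 km]; apply: energy_logconvex Hu _.
  by rewrite km (leq_trans _ k2).
Qed.
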